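(* In the setting described in the context, choose a dimer covering of $G$ uniformly at random. For a diagonal edge $e=\{v,w\}$ of $G$ with $v\in V(H^\perp)$, the probability that $e$ is the impurity of the random dimer covering is $$\frac{p_v}{4\sum_{u\in V(H^\perp)}p_u+d^*-3}.$$
   Context: Let $\Gamma$ be the graph with vertex set $\mathbb Z^2$, divided into white vertices $W=\{(x,y): x+y \text{ even}\}$ and black vertices $B=\mathbb Z^2\setminus W$; $v,v'$ are adjacent iff $v-v'\in\{\pm(1,0),\pm(0,1)\}$, or $v,v'\in W$ and $v-v'\in\{\pm(1,1),\pm(1,-1)\}$ (the latter are diagonal edges). A subgraph of $\Gamma$ is normal if it is induced by a finite vertex set and both it and the subgraph induced by the complementary vertex set are connected. A dimer covering of a graph is a set of its edges covering every vertex exactly once; its impurities are the diagonal edges it contains (in the setting below every dimer covering of $G$ has exactly one impurity). Let $W_0=2\mathbb Z\times 2\mathbb Z$, $W_1=W_0+(1,1)$; $\Lambda$ is the graph on $W_0$ with edges $\{v,v'\}$, $v-v'\in\{\pm(2,0),\pm(0,2)\}$, and $\Lambda^\perp$ the analogous graph on $W_1$. Setting: $H$ is a finite subgraph of $\Lambda$ formed by the boundaries of a finite set $\mathcal F$ of faces of $\Lambda$ (squares of side $2$ with corners in $W_0$), with simply connected union; the centres of these faces lie in $W_1$. $f^*\in W_1$ is a point which is not a centre of a face in $\mathcal F$, chosen so that the subgraph of $\Lambda^\perp$ induced by the face-centres together with $f^*$ is simply connected. $H^\perp$ is the planar dual of $H$ whose outer-face vertex is $f^*$: $V(H^\perp)$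 consists of the face centres and $f^*$, and for every edge $e$ of $H$ there is one edge $e^\perp$ of $H^\perp$ joining the vertices representing the two faces on either side of $e$. $d^*$ is the number of edges of $\Lambda^\perp$ joining $f^*$ to face centres. $v^*$ is a vertex of $H$ on the boundary of the outer face with $v^*-f^*\in\{\pm(1,1),\pm(1,-1)\}$. $G$ is the subgraph of $\Gamma$ induced by $V(H)\cup V(H^\perp)\cup\{\text{midpoints of edges of }H\}$, assumed normal. $A$ is the square matrix indexed by the face centres with entries $a_{u,u}=4$, $a_{u,u'}=-1$ if the faces with centres $u\neq u'$ share an edge of $H$, and $a_{u,u'}=0$ otherwise. $\mathbf b=(b_u)$ is indexed by the face centres with $b_u=1$ if $u$ is adjacent to $f^*$ in $\Lambda^\perp$ and $b_u=0$ otherwise. $(p_u)_{u\ne f^*}=A^{-1}\mathbf b$ and $p_{f^*}=1$. (Equivalently, $p_u$ is the probability that simple random walk on $H^\perp$ started at $u$ first reaches $f^*$ through one of the edges of $\Lambda^\perp$ joining $f^*$ to a face centre.) *)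

(* Defs.v *)
From HB Require Import structures.
From mathcomp Require Import all_boot all_order all_algebra.
Set Implicit Arguments. Unset Strict Implicit. Unset Printing Implicit Defensive.
Import Order.TTheory GRing.Theory Num.Theory.
Local Open Scope ring_scope.

Definition pt := (int * int)%type.
Definition padd (p q : pt) : pt := (p.1 + q.1, p.2 + q.2).
Definition psub (p q : pt) : pt := (p.1 - q.1, p.2 - q.2).

Definition evenz (x : int) : bool := (2 %| x)%Z.
Definition white (p : pt) : bool := evenz (p.1 + p.2).
(* W1 = W0 + (1,1) : both coordinates odd (face centres of Lambda) *)
Definition inW1 (p : pt) : bool := ~~ evenz p.1 && ~~ evenz p.2.

Definition axdirs : seq pt := [:: (1, 0); (-1, 0); (0, 1); (0, -1)].
Definition diagdirs : seq pt := [:: (1, 1); (-1, -1); (1, -1); (-1, 1)].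
Definition axdirs2 : seq pt := [:: (2, 0); (-2, 0); (0, 2); (0, -2)].
Definition diagdirs2 : seq pt := [:: (2, 2); (-2, -2); (2, -2); (-2, 2)].

Definition gadj (v w : pt) : bool :=
  (psub v w \in axdirs) || [&& white v, white w & psub v w \in diagdirs].

Definition lamadj (u w : pt) : bool := [&& inW1 u, inW1 w & psub u w \in axdirs2].

(* closed squares with centres u, w intersect (u <> w) *)
Definition touchadj (u w : pt) : bool := (psub u w \in axdirs2) || (psub u w \in diagdirs2).

Definition connected_in (S : pred pt) (adj : rel pt) : Prop :=
  forall x y, S x -> S y ->
    exists p : seq pt, [/\ path adj x p, last x p = y & all S p].

(* Data built from the list F of face centres and the outer-face point fs *)
Definition cornersH (F : seq pt) : seq pt := [seq padd c d | c <- F, d <- diagdirs].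
Definition midsH (F : seq pt) : seq pt := [seq padd c d | c <- F, d <- axdirs].
Definition VHperp (F : seq pt) (fs : pt) : seq pt := fs :: F.
Definition VG (F : seq pt) (fs : pt) : seq pt :=
  undup (cornersH F ++ VHperp F fs ++ midsH F).

Definition normal_vs (V : seq pt) : Prop :=
  connected_in (mem V) gadj /\ connected_in (predC (mem V)) gadj.

(* union of the closed faces (squares with the given centres) is simply connected:
   it is connected and its complement in the plane is connected *)
Definition faces_simply_connected (F : seq pt) : Prop :=
  connected_in (mem F) touchadj /\
  connected_in [pred x | inW1 x && (x \notin F)] lamadj.

Definition lamperp_simply_connected (S : seq pt) : Prop :=
  connected_in (mem S) lamadj /\
  connected_in [pred x | inW1 x && (x \notin S)] lamadj.

Definition is_edge (V : seq pt) (e : {set seq_sub V}) : bool :=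
  [exists a, exists b, (e == [set a; b]) && gadj (val a) (val b)].

Definition dimer (V : seq pt) (D : {set {set seq_sub V}}) : bool :=
  [forall e in D, is_edge e] &&
  [forall v, #|[set e in D | v \in e]| == 1%N].

Definition Amx (F : seq pt) : 'M[rat]_(size F) :=
  \matrix_(i < size F, j < size F)
    (if i == j then 4
     else if lamadj (nth (0, 0) F i) (nth (0, 0) F j) then -1 else 0).

Definition bvec (F : seq pt) (fs : pt) : 'cV[rat]_(size F) :=
  \col_(i < size F) (if lamadj (nth (0, 0) F i) fs then 1 else 0).

Definition pvec (F : seq pt) (fs : pt) : 'cV[rat]_(size F) :=
  invmx (Amx F) *m bvec F fs.

Definition pfun (F : seq pt) (fs : pt) (u : pt) : rat :=
  if u == fs then 1
  else match [pick i : 'I_(size F) | nth (0, 0) F i == u] with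
       | Some i => pvec F fs i ord0
       | None => 0
       end.

Definition dstar (F : seq pt) (fs : pt) : nat := count (fun u => lamadj u fs) F.

(* Main.v *)
Require Import Defs.
From HB Require Import structures.
From mathcomp Require Import all_boot all_order all_algebra.
From mathcomp Require Import fingroup perm.
From mathcomp Require Import zify ring lra.
Set Implicit Arguments. Unset Strict Implicit. Unset Printing Implicit Defensive.
Import Order.TTheory GRing.Theory Num.Theory.
Local Open Scope ring_scope.

(** Let N(v, w) be the number of dimer coverings containing the diagonal edge {v, w}, and K the matrix of
    incidence signs between the midpoints (edges of H) and the white vertices (vertices and faces of H). Two
    coverings of G minus {v, w} superpose into lattice cycles avoiding v and w; since the diagonal
    neighbours v and w are enclosed together, every cycle encloses an even number of vertices, so all terms in
    the determinant of K without the columns v, w have the same sign and N(v, w) is its absolute value.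
    As K^T K is block diagonal with blocks the Laplacians of H and of the dual, Cramer's rule expresses the
    column of f* through the columns of the faces with coefficients -p_u, and the corner columns sum to zero:
    hence N(v, w) = p_v N(f*, w), with N(f*, w) independent of w and nonzero. A white excess of two gives
    every covering exactly one impurity, each face has four corners, and f* has d* + 1 corners in H because a
    closed walk through f* in the complement of F cannot separate F. *)

(** * Flows and winding numbers on the square lattice *)

(** No Jordan curve theorem is used: the inside of a lattice cycle is measured by an integer stream
    function on the unit squares, its winding number. The sign of a superposition cycle is the
    parity of its area (Green's formula with x dy), and the area is the sum over all vertices p of
    the winding number of the square below and to the right of p. Normality of G removes the
    vertices outside G from this sum, those off the cycle pair up, and those on a cycle of length 2k
    contribute k + 1 modulo 2 by the Umlaufsatz. Euler's formula is avoided as well: K without the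
    columns of f* and w is shown to have trivial left and right kernels, so it is square, and this
    yields the white excess of two. The common value N(f*, w) is never computed since it cancels in
    the quotient. The constant -3 reflects that f* has d* + 1 corners in place of the four of a
    face. *)

Lemma telescope_ord (Z : zmodType) (f : nat -> Z) n :
  \sum_(i < n) (f i - f i.+1) = f 0%N - f n.
Proof.
elim: n => [|n IHn]; first by rewrite big_ord0 subrr.
by rewrite big_ord_recr /= IHn addrA subrK.
Qed.

(* Stream function of a divergence-free flow: R x y and U x y are the flows from the lattice point (x, y)
   to the right and upwards, and s x y lives on the unit square with lower left corner (x, y). *)
Lemma flow_potential (Z : zmodType) (R U : int -> int -> Z) (M : int) :
  (forall x y : int, M <= x -> R x y = 0 /\ U x y = 0) ->
  (forall x y : int, R x y + U x y = R (x - 1) y + U x (y - 1)) ->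
  exists s : int -> int -> Z,
    [/\ forall x y : int, s (x - 1) y - s x y = U x y,
        forall x y : int, s x y - s x (y - 1) = R x y
      & forall x y : int, M <= x -> s x y = 0].
Proof.
move=> far cons; pose n (x : int) := `|M - x|%N.
(* The upward flow through the horizontal ray from the square to the right. Up to abscissa [M] this
   is everything; for [x > M] all terms vanish anyway. *)
pose s x y := \sum_(k < n x) U (x + 1 + k%:Z) y.
have farn x y : R (x + (n x)%:Z) y = 0 by apply: (far _ _ _).1; rewrite /n; lia.
exists s; split=> [x y|x y|x y leMx]; last first.
- by apply: big1 => k _; apply: (far _ _ _).2; lia.
- rewrite -sumrB.
  have balance (A B C D : Z) : A + B = C + D -> B - D = C - A.
    by move=> e; apply/eqP; rewrite subr_eq addrAC -e (addrC A) addrK.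
  under eq_bigr => k _.
    rewrite (balance _ _ _ _ (cons (x + 1 + k%:Z) y)) (_ : x + 1 + k%:Z - 1 = x + k%:Z); last lia.
    over.
  have -> : \sum_(k < n x) (R (x + k%:Z) y - R (x + 1 + k%:Z) y)
      = R x y - R (x + (n x)%:Z) y.
    rewrite -[X in R X y - _]addr0 -(telescope_ord (fun k => R (x + k%:Z) y)).
    by apply: eq_bigr => k _; congr (_ - R _ _); lia.
  by rewrite farn subr0.
have [ltMx|lexM] := ltP M x.
  rewrite (far x y (ltW ltMx)).2 /s !big1 ?subr0 // => k _;
    by apply: (far _ _ _).2; lia.
rewrite /s (_ : n (x - 1) = (n x).+1); last by rewrite /n; lia.
rewrite big_ord_recl (_ : x - 1 + 1 + _ = x); last by rewrite /=; lia.
rewrite -addrA [X in _ + X](_ : _ = 0) ?addr0 // -sumrB big1 // => k _.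
by rewrite (_ : x - 1 + 1 + _ = x + 1 + k%:Z) ?subrr //= /bump /=; lia.
Qed.

(** Antisymmetrised so that backtracking cancels. For a closed walk this flow is divergence-free,
    and its stream function is the winding number around each unit square. *)
Definition net (a : nat -> pt) (n : nat) (p q : pt) : int :=
  \sum_(i < n) (((a i == p) && (a i.+1 == q))%:R - ((a i == q) && (a i.+1 == p))%:R).

Lemma netC a n p q : net a n p q = - net a n q p.
Proof. by rewrite -sumrN; apply: eq_bigr => i _; rewrite opprB. Qed.

Lemma net_off a n p q : (forall i, (i <= n)%N -> a i != p) -> net a n p q = 0.
Proof.
move=> off; apply: big1 => i _.
by rewrite (negbTE (off i _)) ?(negbTE (off i.+1 _)) ?andbF ?subrr // ltnW.
Qed.

Lemma padd_axdirs (p q : pt) :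
  (psub q p \in axdirs) = [|| q == (p.1 + 1, p.2), q == (p.1 - 1, p.2),
    q == (p.1, p.2 + 1) | q == (p.1, p.2 - 1)].
Proof.
case: p q => [a b] [c d]; rewrite /psub !inE !xpair_eqE /=; lia.
Qed.

Lemma walk_potential (a : nat -> pt) (n : nat) :
  a n = a 0%N -> (forall i, (i < n)%N -> psub (a i.+1) (a i) \in axdirs) ->
  exists (M : int) (s : int -> int -> int),
    [/\ forall i, (i <= n)%N -> `|(a i).1| < M /\ `|(a i).2| < M,
        forall x y : int, s (x - 1) y - s x y = net a n (x, y) (x, y + 1),
        forall x y : int, s x y - s x (y - 1) = net a n (x, y) (x + 1, y)
      & forall x y : int, M <= `|x| \/ M <= `|y| -> s x y = 0].
Proof.
move=> closed step.
pose M : int := 2 + \sum_(i < n.+1) (`|(a i).1| + `|(a i).2|).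
have aM i : (i <= n)%N -> `|(a i).1| + `|(a i).2| <= M - 2.
  move=> lein; rewrite /M addrAC subrr add0r (bigD1 (Ordinal (lein : (i < n.+1)%N))) //=.
  by rewrite lerDl sumr_ge0 // => j _; rewrite addr_ge0.
have far (p q : pt) : M <= `|p.1| + 1 \/ M <= `|p.2| + 1 -> net a n p q = 0.
  move=> Mp; apply: net_off => i /aM; apply: contraTneq => ->; lia.
have [s [sU sR s0]] : exists s : int -> int -> int,
    [/\ forall x y : int, s (x - 1) y - s x y = net a n (x, y) (x, y + 1),
        forall x y : int, s x y - s x (y - 1) = net a n (x, y) (x + 1, y)
      & forall x y : int, M <= x -> s x y = 0].
  apply: flow_potential => x y; first by move=> leMx; rewrite !far //=; lia.
  rewrite [RHS]addrC (netC _ _ (x, y - 1)) (netC _ _ (x - 1, y)) subrK subrK.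
  apply/eqP; rewrite -subr_eq0 opprD !opprK -!big_split /=; apply/eqP.
  (* Departures minus arrivals at a vertex telescope along the walk, which is closed. *)
  transitivity ((a 0%N == (x, y))%:R - (a n == (x, y))%:R : int); last by rewrite closed subrr.
  rewrite -(telescope_ord (fun i => (a i == (x, y))%:R : int)); apply: eq_bigr => i _.
  have := step i (ltn_ord i); rewrite padd_axdirs.
  case: (a i) => u v /or4P[] /eqP ->; rewrite !xpair_eqE /=;
    case: (ltgtP u x) => ?; case: (ltgtP v y) => ?; rewrite ?andbF ?andFb /=; lia.
exists (M + 1), s; split=> // [i /aM|x y [] Mx]; first lia; last first.
  (* So far [s] vanishes only far to the right; no flow crosses a row above or below the walk, so
     its value can be read off far to the right. *)
  have rowc k : s (x + k%:Z) y = s x y.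
    elim: k => [|k <-]; first by rewrite addr0.
    have := sU (x + k.+1%:Z) y; rewrite far; last by right; rewrite /=; lia.
    by move/eqP; rewrite subr_eq0 => /eqP <-; congr (s _ _); lia.
  by rewrite -(rowc `|M - x|%N) s0 //; lia.
have [x0|x0] := lerP 0 x; first by apply: s0; lia.
(* To the left of the walk: climb to a row above the walk, then follow that row to the right. *)
have colc k : s x (y + k%:Z) = s x y.
  elim: k => [|k <-]; first by rewrite addr0.
  have := sR x (y + k.+1%:Z); rewrite far; last by left; rewrite /=; lia.
  by move/eqP; rewrite subr_eq0 => /eqP ->; congr (s _ _); lia.
rewrite -(colc `|(M + 1 - y)%R|%N).
set y1 := y + _.
have rowc k : s (x + k%:Z) y1 = s x y1.
  elim: k => [|k <-]; first by rewrite addr0.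
  have := sU (x + k.+1%:Z) y1; rewrite far; last by right; rewrite /y1 /=; lia.
  by move/eqP; rewrite subr_eq0 => /eqP <-; congr (s _ _); lia.
by rewrite -(rowc `|M - x|%N) s0 //; lia.
Qed.

(** * The Umlaufsatz for lattice cycles *)

(* The two kinds of quarter turns that sweep across the ray leaving the origin
   to the right just below the x-axis; [turn_opp] is the same for the opposite ray. *)
Definition turn (e e' : pt) : int :=
  ((e == (0, -1)) && (e' == (1, 0)))%:R - ((e == (1, 0)) && (e' == (0, -1)))%:R.
Definition turn_opp (e e' : pt) : int := turn (psub (0, 0) e) (psub (0, 0) e').

(** Signed crossing of the ray of [turn] by a vector that moves by one lattice step. Unlike [turn]
    it applies to vectors of any length, such as chords of a cycle. *)
Definition sweep (d d' : pt) : int :=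
  [&& 0 < d.1, d.2 == -1 & d' == (d.1, 0)]%:R - [&& 0 < d.1, d.2 == 0 & d' == (d.1, -1)]%:R.

(** The direction turns from [q - p] to [r - q] through the chord [r - p], and both halves of this
    motion are lattice steps. *)
Lemma turn_sweep (p q r : pt) : psub q p \in axdirs -> psub r q \in axdirs -> r != p ->
  turn (psub q p) (psub r q) = sweep (psub q p) (psub r p) + sweep (psub r p) (psub r q).
Proof.
rewrite !padd_axdirs /turn /sweep /psub; case: p q r => x y [x1 y1] [x2 y2] /=.
by case/or4P=> /eqP[-> ->]; case/or4P=> /eqP[-> ->]; rewrite !xpair_eqE; lia.
Qed.

Lemma turn_opp_sweep (p q r : pt) : psub q p \in axdirs -> psub r q \in axdirs -> r != p ->
  turn_opp (psub q p) (psub r q) = sweep (psub p q) (psub p r) + sweep (psub p r) (psub q r).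
Proof.
rewrite !padd_axdirs /turn_opp /turn /sweep /psub; case: p q r => x y [x1 y1] [x2 y2] /=.
by case/or4P=> /eqP[-> ->]; case/or4P=> /eqP[-> ->]; rewrite !xpair_eqE; lia.
Qed.

(** At the topmost and then rightmost vertex [q] the path arrives rightwards or upwards and leaves
    leftwards or downwards without reversing, so exactly one of the two rays is crossed. *)
Lemma turn_topright (p q r : pt) :
  psub q p \in axdirs -> psub r q \in axdirs -> r != p ->
  p.2 <= q.2 /\ (p.2 = q.2 -> p.1 <= q.1) -> r.2 <= q.2 /\ (r.2 = q.2 -> r.1 <= q.1) ->
  `|turn (psub q p) (psub r q) + turn_opp (psub q p) (psub r q)| = 1.
Proof.
move=> qp rq neq top_p top_r.
have {neq} : psub q p != psub q r.
  by apply: contra neq; case: p q r {qp rq top_p top_r} => ? ? [? ?] [? ?];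
     rewrite /psub !xpair_eqE /=; lia.
have {top_p} : 0 <= (psub q p).2 /\ ((psub q p).2 = 0 -> 0 <= (psub q p).1).
  by rewrite /psub /=; lia.
have {top_r} : (psub r q).2 <= 0 /\ ((psub r q).2 = 0 -> (psub r q).1 <= 0).
  by rewrite /psub /=; lia.
rewrite (_ : psub q r = psub (0, 0) (psub r q)); last first.
  by congr pair; rewrite /psub /=; ring.
move: (psub q p) (psub r q) qp rq => [e1 e2] [f1 f2]; rewrite !inE.
by case/or4P=> /eqP[-> ->]; case/or4P=> /eqP[-> ->];
  rewrite /turn_opp /turn /psub !xpair_eqE /=; lia.
Qed.

Lemma sweep_up (u v : int) : sweep (u, v) (u, v + 1) = ((0 < u) && (v == -1))%:R.
Proof. by rewrite /sweep !xpair_eqE eqxx /=; case: (0 < u); lia. Qed.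

Lemma sweep_down (u v : int) : sweep (u, v) (u, v - 1) = - ((0 < u) && (v == 0))%:R.
Proof. by rewrite /sweep !xpair_eqE eqxx /=; case: (0 < u); lia. Qed.

Lemma sweep_down' (u v : int) : sweep (u, v + 1) (u, v) = - ((0 < u) && (v == -1))%:R.
Proof. by rewrite /sweep !xpair_eqE eqxx /=; case: (0 < u); lia. Qed.

Lemma sweep_up' (u v : int) : sweep (u, v - 1) (u, v) = ((0 < u) && (v == 0))%:R.
Proof. by rewrite /sweep !xpair_eqE eqxx /=; case: (0 < u); lia. Qed.

Lemma sweep_row (u u' v v' : int) : u' != u -> sweep (u, v) (u', v') = 0.
Proof. by move=> /negbTE neq; rewrite /sweep !xpair_eqE neq /= !andbF. Qed.

Lemma sweep_square0 (d f g : pt) : f \in axdirs -> g \in axdirs ->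
  d != (0, 0) -> padd d f != (0, 0) -> psub d g != (0, 0) -> psub (padd d f) g != (0, 0) ->
  sweep d (padd d f) + sweep (padd d f) (psub (padd d f) g)
  = sweep d (psub d g) + sweep (psub d g) (psub (padd d f) g).
Proof.
case: d f g => u v [f1 f2] [g1 g2]; rewrite !inE /padd /psub /=.
by case/or4P=> /eqP[-> ->]; case/or4P=> /eqP[-> ->];
  rewrite ?addr0 ?subr0 ?opprK ?addrK ?subrK !xpair_eqE ?sweep_up ?sweep_down ?sweep_up' ?sweep_down' ?sweep_row;
  lia.
Qed.

(* The rotation form of the directions q - p has no curl on lattice squares avoiding the origin. *)
Lemma sweep_square (p p' q q' : pt) :
  psub p' p \in axdirs -> psub q' q \in axdirs -> q != p -> q' != p -> q != p' -> q' != p' ->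
  sweep (psub q p) (psub q' p) + sweep (psub q' p) (psub q' p')
  = sweep (psub q p) (psub q p') + sweep (psub q p') (psub q' p').
Proof.
move=> st st' neq1 neq2 neq3 neq4.
have nz (r t : pt) : r != t -> psub r t != (0, 0).
  by case: r t => ? ? [? ?]; rewrite /psub !xpair_eqE /= !subr_eq0.
have e1 : psub q' p = padd (psub q p) (psub q' q) by congr pair; rewrite /psub /=; ring.
have e2 : psub q p' = psub (psub q p) (psub p' p) by congr pair; rewrite /psub /=; ring.
have e3 : psub q' p' = psub (psub q' p) (psub p' p) by congr pair; rewrite /psub /=; ring.
by rewrite e3 e1 e2; apply: sweep_square0; rewrite -?e1 -?e2 -?e3 -?e1 ?nz.
Qed.

(** Tells on which side of the line made of the two opposite rays [e] lies. Crossing either ray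
    changes the side, which makes [turn - turn_opp] a coboundary. *)
Definition turn_weight (e : pt) : int := ((e == (-1, 0)) || (e == (0, -1)))%:R.

Lemma turn_weightE e : e \in axdirs -> 2 * turn_weight e = 1 - e.1 - e.2.
Proof.
case: e => x y; rewrite /turn_weight !inE.
by case/or4P=> /eqP[-> ->]; rewrite !xpair_eqE.
Qed.

Lemma turn_diff (p q r : pt) : psub q p \in axdirs -> psub r q \in axdirs -> r != p ->
  turn (psub q p) (psub r q) - turn_opp (psub q p) (psub r q)
  = turn_weight (psub q p) - turn_weight (psub r q).
Proof.
rewrite !padd_axdirs /turn_opp /turn /turn_weight /psub; case: p q r => x y [x1 y1] [x2 y2] /=.
by case/or4P=> /eqP[-> ->]; case/or4P=> /eqP[-> ->]; rewrite !xpair_eqE; lia.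
Qed.

Lemma sum_periodic (Z : zmodType) (f : nat -> Z) n r :
  (forall i, f (i + n)%N = f i) -> \sum_(i < n) f (r + i)%N = \sum_(i < n) f i.
Proof.
move=> fD; elim: r => [|r IHr]; first by [].
rewrite -IHr; apply/eqP; rewrite -subr_eq0 -sumrB.
under eq_bigr do rewrite -opprB addSnnS.
by rewrite sumrN (telescope_ord (fun i => f (r + i)%N)) addn0 fD subrr oppr0.
Qed.

Section SimpleCycle.
Variables (a : nat -> pt) (n : nat).
Hypothesis n_gt2 : (2 < n)%N.
Hypothesis aD : forall i, a (i + n)%N = a i.
Hypothesis a_step : forall i, psub (a i.+1) (a i) \in axdirs.
Hypothesis a_inj : forall i j, a i = a j -> i = j %[mod n].

Let e i := psub (a i.+1) (a i).

Lemma cycle_mod i : a (i %% n)%N = a i.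
Proof.
rewrite [in RHS](divn_eq i n); elim: (i %/ n)%N => [|m IHm]; first by rewrite add0n.
by rewrite IHm -[LHS]aD; congr (a _); rewrite mulSn; lia.
Qed.

Lemma cycle_eq i j : (a i == a j) = (i == j %[mod n]).
Proof.
apply/eqP/eqP=> [/a_inj//|eq_ij].
by rewrite -(cycle_mod i) eq_ij cycle_mod.
Qed.

Lemma cycle_neq i k : (0 < k < n)%N -> a (i + k)%N != a i.
Proof.
case/andP=> k0 kn; rewrite cycle_eq -[X in _ != X %[mod n]](addn0 i) eqn_modDl.
by rewrite mod0n modn_small // -lt0n.
Qed.

(** A simple cycle visits [a i.+1] once per period, so only the edges to its two neighbours on the
    cycle carry flow there. *)
Lemma net_cycle i q : net a n (a i.+1) q = (a i.+2 == q)%:R - (a i == q)%:R.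
Proof.
have n0 : (0 < n)%N by lia.
have succE j : (j == i.+1 %[mod n]) -> a j.+1 = a i.+2.
  by move=> eq_ji; apply/eqP; rewrite cycle_eq -addn1 -[i.+2]addn1 eqn_modDr.
rewrite /net sumrB; congr (_ - _).
- rewrite (bigD1 (Ordinal (ltn_pmod i.+1 n0))) //= cycle_mod eqxx /= big1 ?addr0.
    by rewrite (succE (i.+1 %% n)%N) ?modn_mod.
  move=> j; rewrite -val_eqE /= => neq_j; rewrite cycle_eq [(j %% n)%N]modn_small //.
  by rewrite (negbTE neq_j).
- rewrite (bigD1 (Ordinal (ltn_pmod i n0))) //= cycle_mod big1 ?addr0.
    rewrite cycle_eq -addn1 -[i.+1]addn1 modnDml eqxx andbT //.
  move=> j; rewrite -val_eqE /= => neq_j.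
  rewrite [a j.+1 == _]cycle_eq -addn1 -[i.+1]addn1 eqn_modDr [(j %% n)%N]modn_small //.
  by rewrite (negbTE neq_j) andbF.
Qed.

Section Potential.
Variable s : int -> int -> int.
Hypothesis sU : forall x y : int, s (x - 1) y - s x y = net a n (x, y) (x, y + 1).
Hypothesis sR : forall x y : int, s x y - s x (y - 1) = net a n (x, y) (x + 1, y).

Let W i := s (a i).1 ((a i).2 - 1).

(* W i is the value of s on the square below and to the right of the vertex a i. *)
Lemma cycle_potential_step i :
  W i.+2 = W i.+1 + turn_opp (e i) (e i.+1) - turn (e i.+1) (e i.+2).
Proof.
have N1 := net_cycle i; have N2 := net_cycle i.+1.
have neq02 : a i.+2 != a i by rewrite -addn2 cycle_neq.
have neq13 : a i.+3 != a i.+1 by rewrite -[i.+3]addn2 cycle_neq.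
have st0 := a_step i; have st1 := a_step i.+1; have st2 := a_step i.+2.
rewrite !padd_axdirs in st0 st1 st2.
rewrite /W /turn_opp /turn /e; move: st0 st1 st2 N1 N2 neq02 neq13.
case: (a i) => x0 y0; case: (a i.+1) => x y; case: (a i.+2) => x2 y2; case: (a i.+3) => x3 y3.
rewrite /psub /= => st0 /or4P[] /eqP[-> ->] st2 N1 N2; rewrite ?xpair_eqE /= in st0 st2 N1 N2 *.
(* In each of the four directions the two squares share one lattice edge, incident with [a i.+1] or
   [a i.+2]; [net_cycle] tells whether the cycle uses it. *)
- have := sU (x + 1) (y - 1); rewrite netC (_ : y - 1 + 1 = y); last lia.
  rewrite N2 (_ : x + 1 - 1 = x) ?xpair_eqE; last lia.
  case/or4P: st0 => /andP[/eqP ? /eqP ?]; case/or4P: st2 => /andP[/eqP ? /eqP ?]; lia.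
- have := sU x (y - 1); rewrite netC (_ : y - 1 + 1 = y); last lia.
  rewrite N1 ?xpair_eqE.
  case/or4P: st0 => /andP[/eqP ? /eqP ?]; case/or4P: st2 => /andP[/eqP ? /eqP ?]; lia.
- have := sR x y; rewrite (_ : y + 1 - 1 = y); last lia.
  rewrite N1 ?xpair_eqE.
  case/or4P: st0 => /andP[/eqP ? /eqP ?]; case/or4P: st2 => /andP[/eqP ? /eqP ?]; lia.
- have := sR x (y - 1).
  rewrite N2 ?xpair_eqE.
  case/or4P: st0 => /andP[/eqP ? /eqP ?]; case/or4P: st2 => /andP[/eqP ? /eqP ?]; lia.
Qed.

(** By the local step and [turn_diff], the quantity [W i.+1 + turn_opp - turn_weight] is constant
    along the cycle; [c] is its value. *)
Lemma cycle_potential_sum :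
  exists c : int, \sum_(i < n) W i = c * n%:Z + \sum_(i < n) turn_weight (e i)
    - \sum_(i < n) turn_opp (e i) (e i.+1).
Proof.
have eD i : e (i + n)%N = e i by rewrite /e -addSn !aD.
pose c i := W i.+1 + turn_opp (e i) (e i.+1) - turn_weight (e i.+1).
have cE i : c i = c 0%N.
  elim: i => // i <-; rewrite /c cycle_potential_step.
  have : a i.+3 != a i.+1 by rewrite -[i.+3]addn2 cycle_neq.
  move/(turn_diff (a_step i.+1) (a_step i.+2)); rewrite -!/(e _); lia.
exists (c 0%N); rewrite -(sum_periodic (f := W) 1) => [|i]; last by rewrite /W aD.
rewrite -(sum_periodic (f := fun i => turn_weight (e i)) 1) => [|i]; last by rewrite eD.
have -> : c 0%N * n%:Z = \sum_(i < n) c 0%N by rewrite sumr_const card_ord -mulr_natr natz.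
rewrite -big_split -sumrB /=.
by apply: eq_bigr => i _; rewrite -(cE i) /c; ring.
Qed.

End Potential.

(** On a closed walk half of the steps go left or down, as both coordinates telescope. *)
Lemma cycle_turn_weight : 2 * \sum_(i < n) turn_weight (e i) = n%:Z.
Proof.
rewrite mulr_sumr (eq_bigr (fun i : 'I_n => 1 + ((a i).1 - (a i.+1).1) + ((a i).2 - (a i.+1).2))).
  rewrite big_split /= [X in X + _ = _]big_split /= (telescope_ord (fun i => (a i).1)) (telescope_ord (fun i => (a i).2)).
  by rewrite (aD 0 : a n = _) !subrr !addr0 sumr_const card_ord natz.
by move=> i _; rewrite (turn_weightE (a_step i)) /psub /=; ring.
Qed.

(* Hopf's proof of the Umlaufsatz: compare the rotation of the direction a j - a i along the
   diagonal j = i + 1 of the triangle i < j with that along its two legs. *)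
Lemma cycle_turning_topright :
  (forall i, (a i).2 <= (a 0%N).2 /\ ((a i).2 = (a 0%N).2 -> (a i).1 <= (a 0%N).1)) ->
  `|\sum_(i < n) turn (e i) (e i.+1)| = 1.
Proof.
move=> top.
pose D i j := psub (a j) (a i).
pose V i j := sweep (D i j) (D i.+1 j).
have neq i j : (i < j < i + n)%N -> a j != a i.
  by move=> lt; rewrite -(subnKC (_ : i <= j)%N) ?cycle_neq //; lia.
have sq i j : (i.+1 < j)%N -> (j.+1 < i + n)%N ->
    sweep (D i j) (D i j.+1) + V i j.+1 = V i j + sweep (D i.+1 j) (D i.+1 j.+1).
  by move=> ij jn; apply: sweep_square; rewrite ?a_step // neq //; lia.
have tsw i : turn (e i) (e i.+1)
    = sweep (D i i.+1) (D i i.+2) + sweep (D i i.+2) (D i.+1 i.+2).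
  by apply: turn_sweep => //; rewrite neq //; lia.
(* The path along the legs cuts off the corner (0, m + 3) of the triangle through (1, m + 2): for m
   + 3 = n the direction at that corner is the zero vector, where no rotation is defined. *)
have main m : (m + 3 <= n)%N -> \sum_(i < m.+2) turn (e i) (e i.+1) =
    \sum_(j < m.+1) sweep (D 0%N j.+1) (D 0%N j.+2) + V 0%N m.+2
    + sweep (D 1%N m.+2) (D 1%N m.+3) + \sum_(i < m.+1) V i.+1 m.+3.
  elim: m => [|m IHm] len; first by rewrite !(big_ord_recr, big_ord0) /= !tsw /V; ring.
  rewrite big_ord_recr /= IHm ?tsw; last by lia.
  rewrite [in RHS]big_ord_recr [X in _ = _ + X]big_ord_recr /=.
  have sq0 := sq 0%N m.+2 isT; rewrite add0n in sq0.
  have diag : sweep (D 1%N m.+3) (D 1%N m.+4) + \sum_(i < m.+1) V i.+1 m.+4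
      = \sum_(i < m.+1) V i.+1 m.+3 + sweep (D m.+2 m.+3) (D m.+2 m.+4).
    pose f i := sweep (D i.+1 m.+3) (D i.+1 m.+4).
    have := telescope_ord f m.+1.
    rewrite (eq_bigr (fun i : 'I_m.+1 => V i.+1 m.+3 - V i.+1 m.+4)) => [|i _].
      rewrite sumrB /f; move: (\sum_(i < m.+1) V i.+1 m.+3) (\sum_(i < m.+1) V i.+1 m.+4) => S3 S4; lia.
    have lt_im := ltn_ord i.
    have := sq i.+1 m.+3 ltac:(lia) ltac:(lia); rewrite /f; lia.
  move: diag (sq0 ltac:(lia)); rewrite -/(V m.+2 m.+4); clearbody V.
  move: (\sum_(i < m.+1) V i.+1 m.+3) (\sum_(i < m.+1) V i.+1 m.+4) => S3 S4.
  move: (\sum_(i < m.+1) sweep _ _) => S0; lia.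
have a_n : a n = a 0%N by rewrite -[n]add0n aD.
case: n n_gt2 a_n aD neq main => [|[|[|m]]] // _ a_n aD' neq' main.
have := main m; rewrite addn3 leqnn => /(_ isT).
(* All vertices lie below [a 0], or level with it and to its left, so the directions from [a 0] on
   one leg and towards [a 0] on the other never cross the ray. *)
rewrite [X in _ = X + _ + _ + _]big1 => [|j _]; last first.
  have := top j.+1; have := top j.+2; rewrite /sweep /D /psub !xpair_eqE /=; lia.
rewrite [X in _ = _ + X]big1 => [|j _]; last first.
  rewrite /V /D a_n; have := top j.+1; have := top j.+2; rewrite /sweep /psub !xpair_eqE /=; lia.
rewrite add0r addr0 => mainE; rewrite big_ord_recr /= mainE.
have := a_step m.+2; have := a_step 0%N; have := top 1%N; have := top m.+2.
have : a m.+2 != a 1%N by rewrite neq' //; lia.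
rewrite /V /D /e (_ : a m.+4 = a 1%N) ?a_n; last by rewrite -[m.+4]add1n aD'.
move=> neq21 top2 top1 step0 step2.
(* What remains is the cut corner, which equals [turn_opp] at [a 0], and the last summand, which is
   [turn] there. *)
by rewrite eq_sym in neq21; rewrite -turn_opp_sweep // addrC turn_topright.
Qed.

End SimpleCycle.

Section CycleParity.
Variables (a : nat -> pt) (n : nat).
Hypothesis n_gt2 : (2 < n)%N.
Hypothesis aD : forall i, a (i + n)%N = a i.
Hypothesis a_step : forall i, psub (a i.+1) (a i) \in axdirs.
Hypothesis a_inj : forall i j, a i = a j -> i = j %[mod n].

Lemma cycle_topright : exists r,
  forall i, (a i).2 <= (a r).2 /\ ((a i).2 = (a r).2 -> (a i).1 <= (a r).1).
Proof.
have n0 : (0 < n)%N by lia.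
case: (@Order.TotalTheory.arg_maxP _ _ _ (Ordinal n0) xpredT (fun i => (a i).2)) => // t _ top.
case: (@Order.TotalTheory.arg_maxP _ _ _ t (fun i => (a i).2 == (a t).2) (fun i => (a i).1)) => //.
move=> r /eqP rt right; exists r => i; rewrite -(cycle_mod n_gt2 aD i).
pose i' := Ordinal (ltn_pmod i n0); rewrite (_ : (i %% n)%N = i') // rt.
by split; [apply: top | move/eqP; apply: right].
Qed.

Lemma cycle_turning : `|\sum_(i < n) turn (psub (a i.+1) (a i)) (psub (a i.+2) (a i.+1))| = 1.
Proof.
have [r top] := cycle_topright.
pose f i := turn (psub (a i.+1) (a i)) (psub (a i.+2) (a i.+1)).
rewrite -(@sum_periodic _ f _ r) => [|i]; last by rewrite /f -!addSn !aD.
have main := @cycle_turning_topright (fun i => a (r + i)%N) n n_gt2.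
rewrite /f; under eq_bigr do rewrite -!addnS; apply: main => [i|i|i j /a_inj/eqP|i].
- by rewrite addnA aD.
- by rewrite addnS.
- by rewrite eqn_modDl => /eqP.
- by rewrite addn0.
Qed.

(* Pick's formula modulo 2, for the boundary points of a simple cycle. *)
Lemma cycle_potential_parity (s : int -> int -> int) k :
  (forall x y : int, s (x - 1) y - s x y = net a n (x, y) (x, y + 1)) ->
  (forall x y : int, s x y - s x (y - 1) = net a n (x, y) (x + 1, y)) ->
  n = k.*2 -> exists z, \sum_(i < n) s (a i).1 ((a i).2 - 1) = 2 * z + k%:Z + 1.
Proof.
move=> sU sR nk.
have [c ->] := cycle_potential_sum n_gt2 aD a_step a_inj sU sR.
have := cycle_turning; have := cycle_turn_weight aD a_step.
set tau := \sum_(i < n) turn _ _.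
(* Both rays have the same total crossing number, since the difference is a coboundary on a closed
   cycle. *)
have -> : \sum_(i < n) turn_opp (psub (a i.+1) (a i)) (psub (a i.+2) (a i.+1)) = tau.
  apply/esym/eqP; rewrite -subr_eq0 -sumrB.
  rewrite (eq_bigr (fun i : 'I_n => turn_weight (psub (a i.+1) (a i))
      - turn_weight (psub (a i.+2) (a i.+1)))) => [|i _].
    rewrite (telescope_ord (fun i => turn_weight (psub (a i.+1) (a i)))).
    by rewrite (aD 0 : a n = _) (aD 1 : a n.+1 = _) subrr.
  by apply: turn_diff => //; rewrite -addn2 (cycle_neq n_gt2 aD a_inj).
move: (\sum_(i < n) _) tau => m tau; rewrite nk => mk tau1.
have [t1|t1] : tau = 1 \/ tau = -1 by lia.
  by exists (c * k%:Z - 1); rewrite t1; lia.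
by exists (c * k%:Z); rewrite t1; lia.
Qed.

End CycleParity.

Lemma big_seq_support (Z : zmodType) (T : eqType) (r1 r2 : seq T) (f : T -> Z) :
  uniq r1 -> uniq r2 -> (forall x, f x != 0 -> (x \in r1) && (x \in r2)) ->
  \sum_(x <- r1) f x = \sum_(x <- r2) f x.
Proof.
move=> u1 u2 supp.
have nz r : \sum_(x <- r) f x = \sum_(x <- [seq x <- r | f x != 0]) f x.
  by rewrite big_filter [RHS]big_mkcond; apply: eq_bigr => x _; case: eqP.
rewrite nz [RHS]nz; apply/perm_big/uniq_perm; rewrite ?filter_uniq // => x.
by rewrite !mem_filter; case: eqP => //= /eqP/supp/andP[-> ->].
Qed.

(** Green's formula: the total winding number is the integral of x dy along the walk. Each square is
    indexed by its upper left vertex, and [V] may be any finite set containing the support. *)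
Lemma walk_area (a : nat -> pt) n (s : int -> int -> int) (M : int) (V : seq pt) :
  (forall i, (i < n)%N -> psub (a i.+1) (a i) \in axdirs) ->
  (forall i, (i <= n)%N -> `|(a i).1| < M /\ `|(a i).2| < M) ->
  (forall x y : int, s (x - 1) y - s x y = net a n (x, y) (x, y + 1)) ->
  (forall x y : int, M <= `|x| \/ M <= `|y| -> s x y = 0) ->
  uniq V -> (forall p, s p.1 (p.2 - 1) != 0 -> p \in V) ->
  \sum_(p <- V) s p.1 (p.2 - 1) = \sum_(i < n) ((a i.+1).2 - (a i).2) * (a i).1.
Proof.
move=> step aM sU s0 uV sV.
pose m := `|(2 * M + 1)%R|%N; pose c (i : nat) : int := i%:Z - M.
pose box := [seq (c i, c j) | i <- iota 0 m, j <- iota 0 m].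
have box_uniq : uniq box.
  by apply: allpairs_uniq; rewrite ?iota_uniq // => -[i j] [i' j'] _ _ /= [ei ej]; congr pair; move: ei ej; rewrite /c; lia.
have boxP (p : pt) : `|p.1| <= M -> `|p.2| <= M -> p \in box.
  case: p => x y /= xM yM; apply/allpairsP; exists (`|(x + M)%R|%N, `|(y + M)%R|%N).
  by rewrite !mem_iota /c /m /=; split; try lia; congr pair; lia.
rewrite (@big_seq_support _ _ _ box) // => [|p nz]; last first.
  rewrite sV // boxP //; apply: contraNT nz => big; apply/eqP/s0; lia.
have pickV (q : pt) (g : pt -> int) : `|q.1| <= M -> `|q.2| <= M ->
    \sum_(p <- box) (q == p)%:R * g p = g q.
  move=> q1 q2; rewrite (bigD1_seq q) ?boxP //= eqxx mul1r big1 ?addr0 // => p.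
  by rewrite eq_sym => /negbTE->; rewrite mul0r.
have M0 : 0 <= M by have := aM 0%N isT; lia.
(* Abel summation along each row replaces [s] by the abscissa times the horizontal difference of
   [s], which is the flow through a vertical edge. *)
transitivity (\sum_(p <- box) p.1 * net a n (p.1, p.2 - 1) p).
  have iotaE : iota 0 m = index_iota 0 m by rewrite /index_iota subn0.
  rewrite !big_allpairs_dep exchange_big [RHS]exchange_big /= iotaE; apply: eq_bigr => j _.
  rewrite !big_mkord; set y := c j - 1; rewrite (_ : c j = y + 1); last by rewrite /y; lia.
  pose g i := c i * s (c i - 1) y.
  apply/eqP; rewrite eq_sym -subr_eq0 -sumrB (eq_bigr (fun i : 'I_m => g i - g i.+1)) => [|i _].
    rewrite (telescope_ord g) /g !s0 ?mulr0 ?subrr // /c /m; lia.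
  have c1 : c i.+1 = c i + 1 by rewrite /c; lia.
  by rewrite -sU /g c1 addrK; move: (c i) (s _ _) (s _ _) => *; ring.
under eq_bigr do rewrite mulr_sumr.
rewrite exchange_big /=; apply: eq_bigr => i _.
have := aM i (ltnW (ltn_ord i)); have := aM i.+1 (ltn_ord i); have := step i (ltn_ord i).
move: (a i) (a i.+1) => q r qr [r1 r2] [q1 q2].
transitivity (\sum_(p <- box) ((r == p)%:R * (p.1 * (q == (p.1, p.2 - 1))%:R)
    - (q == p)%:R * (p.1 * (r == (p.1, p.2 - 1))%:R))).
  apply: eq_bigr => p _.
  by case: (r == p); case: (q == p); case: (q == _); case: (r == _); rewrite /=; ring.
rewrite sumrB !pickV; try lia.
move: qr; rewrite padd_axdirs; case: q {q1 q2} => x y; case: r {r1 r2} => x' y' /=.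
by case/or4P=> /eqP[-> ->]; rewrite !xpair_eqE /=; lia.
Qed.

(** * Kasteleyn signs and matchings *)

(** No flow leaves or enters [p], so the four unit squares around it have the same winding number;
    the booleans [i] and [j] select one of them. *)
Lemma walk_off (a : nat -> pt) n (s : int -> int -> int) (p : pt) (i j : bool) :
  (forall x y : int, s (x - 1) y - s x y = net a n (x, y) (x, y + 1)) ->
  (forall x y : int, s x y - s x (y - 1) = net a n (x, y) (x + 1, y)) ->
  (forall i, (i <= n)%N -> a i != p) -> s (p.1 - i%:R) (p.2 - j%:R) = s p.1 (p.2 - 1).
Proof.
case: p => x y sU sR off /=.
have n0 q : net a n (x, y) q = 0 by apply: net_off.
have n0' q : net a n q (x, y) = 0 by rewrite netC n0 oppr0.
have := sU x y; have := sU x (y - 1); have := sR x y; have := sR (x - 1) y.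
by rewrite !subrK !n0 !n0'; case: i; case: j; rewrite ?mulr1n ?mulr0n ?subr0; lia.
Qed.

(** Neighbours, diagonal ones included, are vertices of a common unit square, and [walk_off] moves
    both values to that square. *)
Lemma potential_off (a : nat -> pt) n (s : int -> int -> int) (p q : pt) :
  (forall x y : int, s (x - 1) y - s x y = net a n (x, y) (x, y + 1)) ->
  (forall x y : int, s x y - s x (y - 1) = net a n (x, y) (x + 1, y)) ->
  (forall i, (i <= n)%N -> a i != p) -> (forall i, (i <= n)%N -> a i != q) ->
  psub p q \in axdirs ++ diagdirs -> s p.1 (p.2 - 1) = s q.1 (q.2 - 1).
Proof.
move=> sU sR offp offq.
have Ep i j := walk_off i j sU sR offp; have Eq i j := walk_off i j sU sR offq.
case: p q {offp offq} Ep Eq => x y [x' y'] /= Ep Eq pq.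
(* The lower left vertex of the common square takes the smaller of the two abscissas and of the two
   ordinates. *)
have [i [j [i' [j' [e1 e2]]]]] : exists i j i' j' : bool,
    x - i%:R = x' - i'%:R /\ y - j%:R = y' - j'%:R.
  exists (x' < x), (y' < y), (x < x'), (y < y').
  move: pq; rewrite /psub !inE !xpair_eqE /=.
  by case: (ltgtP x x') => ?; case: (ltgtP y y') => ? /=; lia.
by rewrite -(Ep i j) -(Eq i' j') e1 e2.
Qed.

Lemma seq_bounded (V : seq pt) : exists N : int, forall p : pt, p \in V -> `|p.1| < N /\ `|p.2| < N.
Proof.
elim: V => [|q V [N IHV]]; first by exists 0.
exists (`|N| + `|q.1| + `|q.2| + 1) => p; rewrite inE => /predU1P[->|/IHV]; lia.
Qed.

(** This is where normality enters: the complement of [V] is connected, so [p] is joined off the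
    walk to a point so far away that the winding number is zero. *)
Lemma potential_outside (a : nat -> pt) n (s : int -> int -> int) (M : int) (V : seq pt) (p : pt) :
  (forall x y : int, s (x - 1) y - s x y = net a n (x, y) (x, y + 1)) ->
  (forall x y : int, s x y - s x (y - 1) = net a n (x, y) (x + 1, y)) ->
  (forall x y : int, M <= `|x| \/ M <= `|y| -> s x y = 0) ->
  connected_in (predC (mem V)) gadj -> (forall i, (i <= n)%N -> a i \in V) ->
  p \notin V -> s p.1 (p.2 - 1) = 0.
Proof.
move=> sU sR s0 conn aV pV; have [N VN] := seq_bounded V.
pose q : pt := (`|M| + `|N|, 0).
have qV : q \notin V by apply/negP => /VN; rewrite /q /=; lia.
have [c [cpath clast call]] := conn p q pV qV.
suff -> : s p.1 (p.2 - 1) = s q.1 (q.2 - 1) by apply: s0; rewrite /q /=; lia.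
rewrite -clast; elim: c p pV cpath {clast} call => [|r c IHc] p pV //=.
case/andP=> pr rc /andP[rV cV]; rewrite -IHc //.
have off (u : pt) : u \notin V -> forall i, (i <= n)%N -> a i != u.
  by move=> uV i /aV; apply: contraTneq => ->.
apply: (potential_off sU sR); [exact: off | exact: off |]; rewrite mem_cat.
by case/orP: pr => [->//|/and3P[_ _ ->]]; rewrite orbT.
Qed.

Definition par (z : int) : bool := ~~ evenz z.

Lemma parD x y : par (x + y) = par x (+) par y.
Proof. by rewrite /par /evenz; lia. Qed.

Definition half_par (p : pt) : bool :=
  par (p.1 %/ 2)%Z (+) par (p.2 %/ 2)%Z (+) ~~ white p.

(* Up to the gauge [half_par], the sign -1 is carried by the vertical edges with odd abscissa;
   the gauge turns this into the incidence signs between the vertices or faces and the edges of Lambda. *)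
Definition kast (p q : pt) : rat :=
  if psub p q \in axdirs
  then (-1) ^+ (half_par p (+) half_par q (+) (par p.1 && (p.1 == q.1))) else 0.

Lemma psubC_axdirs p q : (psub p q \in axdirs) = (psub q p \in axdirs).
Proof. by case: p q => x y [x' y']; rewrite /psub !inE !xpair_eqE /=; lia. Qed.

Lemma kastC p q : kast p q = kast q p.
Proof.
rewrite /kast psubC_axdirs; case: ifP => // _; congr (_ ^+ nat_of_bool _).
by rewrite [half_par q (+) _]addbC [q.1 == _]eq_sym; case: eqP => [->|_]; rewrite ?andbF.
Qed.

Lemma kast_sqr p q : psub p q \in axdirs -> kast p q * kast p q = 1.
Proof. by rewrite /kast => ->; rewrite -signr_addb addbb. Qed.

(** The gauge telescopes, and the vertical edges with odd abscissa add up to the parity of the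
    integral of x dy, which [walk_area] identifies with the enclosed area. *)
Lemma prod_kast (a : nat -> pt) n : (forall i, psub (a i.+1) (a i) \in axdirs) ->
  \prod_(i < n) kast (a i) (a i.+1) = (-1) ^+ (half_par (a 0%N) (+) half_par (a n)
    (+) par (\sum_(i < n) ((a i.+1).2 - (a i).2) * (a i).1)).
Proof.
move=> step; elim: n => [|n IHn]; first by rewrite !big_ord0 addbb.
rewrite !big_ord_recr /= IHn parD /kast psubC_axdirs step -signr_addb.
have -> : par (((a n.+1).2 - (a n).2) * (a n).1) = par (a n).1 && ((a n).1 == (a n.+1).1).
  have := step n; rewrite padd_axdirs; case: (a n) => x y /or4P[] /eqP -> /=.
  - by rewrite subrr mul0r /par /evenz; lia.
  - by rewrite subrr mul0r /par /evenz; lia.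
  - by rewrite addrAC subrr add0r mul1r eqxx andbT.
  - by rewrite addrAC subrr add0r mulN1r eqxx andbT /par /evenz; lia.
congr (_ ^+ nat_of_bool _).
by case: (half_par _); case: (half_par _); case: (half_par _); case: (par _); case: (_ && _).
Qed.

(** * Signs of permutations and superposition of matchings *)

Lemma partition_porbits (T : finType) (s : {perm T}) : partition (porbits s) [set: T].
Proof.
apply/and3P; split.
- apply/eqP/setP => x; rewrite inE; apply/bigcupP; exists (porbit s x); rewrite ?porbit_id //.
  exact: imset_f.
- apply/trivIsetP => _ _ /imsetP[x _ ->] /imsetP[y _ ->]; apply: contraR.
  case/pred0Pn => z /andP[/= zx zy]; move: zx zy.
  by rewrite -!eq_porbit_mem => /eqP<- /eqP->.
- by apply/imsetP => -[x _ /esym/setP/(_ x)]; rewrite porbit_id inE.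
Qed.

(** A cycle of length l has sign (-1)^(l + 1), so [F] compensates the sign of [s] orbit by orbit. *)
Lemma sign_perm_porbits (R : comNzRingType) (T : finType) (s : {perm T}) (F : T -> R) :
  (forall x, \prod_(y in porbit s x) F y = (-1) ^+ #|porbit s x|.+1) ->
  (-1) ^+ s * \prod_x F x = 1.
Proof.
move=> FO; have part := partition_porbits s.
have -> : \prod_x F x = \prod_(x in [set: T]) F x by apply: eq_bigl => x; rewrite inE.
rewrite (set_partition_big _ part) /=.
rewrite (eq_bigr (fun O : {set T} => (-1) ^+ #|O|.+1)) => [|_ /imsetP[x _ ->]]; last exact: FO.
have sumE : (\sum_(O in porbits s) #|O|.+1 = #|T| + #|porbits s|)%N.
  rewrite -cardsT (card_partition part) -[#|porbits s|]sum1_card -big_split /=.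
  by apply: eq_bigr => O _; rewrite addn1.
by rewrite prodrXr sumE -[X in _ * X]signr_odd oddD -signr_addb addbb.
Qed.

Lemma big_porbit (R : Type) (idx : R) (op : Monoid.com_law idx) (T : finType) (s : {perm T}) x
    (F : T -> R) :
  \big[op/idx]_(y in porbit s x) F y = \big[op/idx]_(i < #|porbit s x|) F (iter i s x).
Proof.
rewrite (eq_bigl (mem (traject s x #|porbit s x|))) => [|y]; last exact: porbit_traject.
rewrite -big_uniq ?uniq_traject_porbit //= (big_nth x) size_traject big_mkord.
by apply: eq_bigr => i _; rewrite nth_traject.
Qed.

Lemma iter_porbit_inj (T : finType) (s : {perm T}) x i j :
  iter i s x = iter j s x -> i = j %[mod #|porbit s x|].
Proof.
set k := #|_|; have k0 : (0 < k)%N by rewrite lt0n /k card_porbit_neq0.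
have modE l : iter (l %% k) s x = iter l s x.
  rewrite [in RHS](divn_eq l k) addnC iterD; congr iter.
  by elim: (l %/ k)%N => // d IHd; rewrite mulSn iterD -IHd iter_porbit.
rewrite -(modE i) -(modE j) => eq_ij; apply/eqP.
rewrite -(nth_uniq x _ _ (uniq_traject_porbit s x)) ?size_traject ?ltn_pmod //.
by rewrite !nth_traject ?ltn_pmod // eq_ij.
Qed.

Lemma big_porbit_shift (R : Type) (idx : R) (op : Monoid.com_law idx) (T : finType)
    (s : {perm T}) x (F : T -> R) :
  \big[op/idx]_(y in porbit s x) F (s y) = \big[op/idx]_(y in porbit s x) F y.
Proof.
rewrite [RHS](reindex_inj (@perm_inj _ s)); apply: eq_bigl => y.
by rewrite -!eq_porbit_mem (porbit_perm s 1).
Qed.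

Lemma big_double (R : Type) (idx : R) (op : Monoid.com_law idx) (F : nat -> R) k :
  \big[op/idx]_(i < k.*2) F i = \big[op/idx]_(i < k) op (F i.*2) (F i.*2.+1).
Proof.
elim: k => [|k IHk]; first by rewrite !big_ord0.
by rewrite doubleS !big_ord_recr /= IHk Monoid.mulmA.
Qed.

Section Matchings.
Variables (V : seq pt) (m : nat) (bn wn : 'I_m -> pt) (v w : pt).
Hypothesis V_conn : connected_in (predC (mem V)) gadj.
Hypothesis V_uniq : uniq V.
Hypothesis V_enum : perm_eq V ([seq bn i | i : 'I_m] ++ [seq wn i | i : 'I_m] ++ [:: v; w]).
Hypothesis bn_black : forall i, ~~ white (bn i).
Hypothesis wn_white : forall i, white (wn i).
Hypothesis v_white : white v.
Hypothesis vw : psub v w \in diagdirs.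

Definition compatible (s : 'S_m) := forall i, psub (wn (s i)) (bn i) \in axdirs.

Lemma matching_enum : [/\ injective bn, injective wn,
  forall i, wn i != v & forall i, wn i != w].
Proof.
have := V_uniq; rewrite (perm_uniq V_enum) !cat_uniq => /and3P[ub _ /and3P[uw hvw _]].
have notin i u : u \in [:: v; w] -> wn i != u.
  move=> uvw; apply: contra hvw => /eqP eq_u; apply/hasP; exists u => //=.
  by rewrite -eq_u image_f.
by split=> [||i|i]; [exact/injectiveP | exact/injectiveP | |]; apply: notin; rewrite !inE eqxx ?orbT.
Qed.

Section Orbit.
Variables (s s' : 'S_m) (x : 'I_m).
Hypotheses (cs : compatible s) (cs' : compatible s').
Let p : 'S_m := (s' * s^-1)%g.
Let k := #|porbit p x|.
(** The lattice cycle of the superposition: from a black vertex along its edge in [s'] to a white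
    one, then back along the edge of [s] to the black vertex [p] leads to. *)
Let a i := if odd i then wn (s' (iter i./2 p x)) else bn (iter i./2 p x).

Let pE y : s (p y) = s' y. Proof. by rewrite permM permKV. Qed.

Let aD i : a (i + k.*2)%N = a i.
Proof. by rewrite /a oddD odd_double addbF halfD odd_double andbF doubleK add0n iterD iter_porbit. Qed.

Let a_step i : psub (a i.+1) (a i) \in axdirs.
Proof.
rewrite /a /= uphalf_half; case: (odd i) => /=; last exact: cs'.
by rewrite -pE psubC_axdirs; apply: cs.
Qed.

Let a_inj i j : a i = a j -> i = j %[mod k.*2].
Proof.
have [bn_inj wn_inj _ _] := matching_enum.
have evenodd y z : bn y <> wn z by move=> e; have := bn_black y; rewrite e wn_white.
have half_eq : odd i = odd j -> i./2 = j./2 %[mod k] -> i = j %[mod k.*2].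
  move=> oij hij; rewrite -(odd_double_half i) -(odd_double_half j) oij.
  by apply/eqP; rewrite eqn_modDl -!mul2n -!muln_modr hij.
rewrite /a; case oi: (odd i); case oj: (odd j) => eq_a.
- by apply: half_eq; rewrite ?oi //; apply/iter_porbit_inj/(@perm_inj _ s')/wn_inj.
- by have /esym/evenodd := eq_a.
- by have /evenodd := eq_a.
- by apply: half_eq; rewrite ?oi //; apply/iter_porbit_inj/bn_inj.
Qed.

(* The product is (-1) to the area enclosed by the cycle; off the cycle, each enclosed vertex is
   matched with an enclosed neighbour, and v and w are enclosed together, so only the boundary counts. *)
Lemma orbit_kast :
  \prod_(y in porbit p x) (kast (bn y) (wn (s y)) * kast (bn y) (wn (s' y))) = (-1) ^+ k.+1.
Proof.
(* A fixed point of [p] is an edge common to both matchings: there is no cycle, only a squared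
   sign. *)
have [k1|k_neq1] := eqVneq k 1%N.
  rewrite (big_porbit _ _ _ _) -/k k1 big_ord1 /=.
  have /= px := iter_porbit p x; rewrite -/k k1 /= in px.
  by rewrite -pE px kast_sqr ?expr2 ?mulrNN ?mulr1 // psubC_axdirs; apply: cs.
have k_gt1 : (1 < k)%N by rewrite ltn_neqAle eq_sym k_neq1 lt0n card_porbit_neq0.
have n_gt2 : (2 < k.*2)%N by rewrite (ltn_double 1).
have -> : \prod_(y in porbit p x) (kast (bn y) (wn (s y)) * kast (bn y) (wn (s' y)))
    = \prod_(i < k.*2) kast (a i) (a i.+1).
  rewrite big_split /= -(@big_porbit_shift _ _ *%R _ p x (fun y => kast (bn y) (wn (s y)))) -big_split /=.
  rewrite big_porbit (big_double *%R (fun i => kast (a i) (a i.+1))); apply: eq_bigr => i _.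
  rewrite /a /= odd_double uphalf_double doubleK /= mulrC pE.
  by rewrite [kast (bn (p _)) _]kastC.
have [M [sp [aM sU sR s0]]] := walk_potential (aD 0) (fun i _ => a_step i).
have aV i : a i \in V.
  by rewrite (perm_mem V_enum) /a !mem_cat; case: (odd i); rewrite image_f ?orbT.
have outV q : sp q.1 (q.2 - 1) != 0 -> q \in V.
  by apply: contraR => qV; apply/eqP/(potential_outside sU sR s0 V_conn).
have [z sumC] := cycle_potential_parity n_gt2 aD a_step a_inj sU sR erefl.
have area := walk_area (fun i _ => a_step i) aM sU s0 V_uniq outV.
rewrite prod_kast // (aD 0 : a k.*2 = _) addbb addFb -area.
have [bn_inj wn_inj wn_v wn_w] := matching_enum.
pose f (q : pt) := sp q.1 (q.2 - 1).
have w_white : white w.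
  by move: v_white vw; rewrite /white /evenz /psub !inE !xpair_eqE /=; lia.
have bn_neq i u : white u -> bn i != u.
  by apply: contraTneq => <-; apply: bn_black.
have in_orbit l : iter l p x \in porbit p x by rewrite -permX mem_porbit.
have a_neq_vw u : u \in [:: v; w] -> forall i, (i <= k.*2)%N -> a i != u.
  move=> uvw i _; rewrite /a; case: ifP => _.
    by move: uvw; rewrite !inE => /orP[]/eqP->.
  by apply: bn_neq; move: uvw; rewrite !inE => /orP[]/eqP->.
have fvw : f v = f w.
  apply: (potential_off sU sR); rewrite ?mem_cat ?vw ?orbT //; apply: a_neq_vw; rewrite !inE eqxx ?orbT //.
have foff y : y \notin porbit p x -> f (bn y) = f (wn (s y)).
  move=> yO; apply: (potential_off sU sR); last by rewrite mem_cat psubC_axdirs cs.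
  - move=> i _; rewrite /a; case: ifP => _; first by rewrite eq_sym bn_neq.
    by apply: contraNneq yO => /bn_inj <-.
  - move=> i _; rewrite /a; case: ifP => _; last exact: bn_neq.
    rewrite -pE; apply: contraNneq yO => /wn_inj/perm_inj <-.
    by rewrite -iterS.
have sumO : \sum_(y in porbit p x) (f (bn y) + f (wn (s y))) = 2 * z + k%:Z + 1.
  rewrite -sumC big_split /= -(@big_porbit_shift _ _ +%R _ p x (fun y => f (wn (s y)))) -big_split /=.
  rewrite big_porbit (big_double +%R (fun i => f (a i))); apply: eq_bigr => i _.
  by rewrite /a /= odd_double uphalf_double doubleK /= pE.
have -> : \sum_(q <- V) f q
    = 2 * z + k%:Z + 1 + 2 * (\sum_(y | y \notin porbit p x) f (bn y) + f v).
  rewrite (perm_big _ V_enum) !big_cat /= !big_image /= !big_cons big_nil -fvw.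
  rewrite [X in _ + (X + _)](reindex_inj (@perm_inj _ s)) /= addrA -big_split /=.
  rewrite (bigID (mem (porbit p x))) /= sumO.
  rewrite [X in _ + X + _](eq_bigr (fun y => f (bn y) + f (bn y))) => [|y /foff <- //].
  by rewrite big_split /=; ring.
rewrite -[RHS]signr_odd; congr (_ ^+ nat_of_bool _).
by move: (_ + f v) => t; rewrite /par /evenz; lia.
Qed.
End Orbit.

Lemma matching_sign (s s' : 'S_m) : compatible s -> compatible s' ->
  (-1) ^+ s * \prod_i kast (bn i) (wn (s i)) = (-1) ^+ s' * \prod_i kast (bn i) (wn (s' i)).
Proof.
move=> cs cs'.
have := sign_perm_porbits (fun x => orbit_kast x cs cs').
rewrite odd_permM odd_permV signr_addb big_split /=.
set A := \prod_i _; set B := \prod_i _ => eq1.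
have sq t : compatible t -> (\prod_i kast (bn i) (wn (t i))) ^+ 2 = 1.
  move=> ct; rewrite -prodrXl big1 // => i _; rewrite expr2 kast_sqr // psubC_axdirs; apply: ct.
have /eqP := sq s cs; rewrite -/A sqrf_eq1 => A1.
have /eqP := sq s' cs'; rewrite -/B sqrf_eq1 => B1.
move: eq1; case: (odd_perm s); case: (odd_perm s'); case/pred2P: A1 => ->; case/pred2P: B1 => ->;
  by rewrite ?expr0 ?expr1; lra.
Qed.
End Matchings.

(** * Dimer coverings and determinants *)

Lemma gadjC p q : gadj p q = gadj q p.
Proof.
rewrite /gadj psubC_axdirs; congr orb; rewrite andbCA; congr [&& _, _ & _].
by case: p q => x y [x' y']; rewrite /psub !inE !xpair_eqE /=; lia.
Qed.

Lemma gadj_irr p : ~~ gadj p p.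
Proof. by case: p => x y; rewrite /gadj /psub /= !subrr !inE /= !andbF. Qed.

Lemma axdirs_white p q : psub p q \in axdirs -> white p = ~~ white q.
Proof. by case: p q => x y [x' y']; rewrite /psub /white /evenz !inE !xpair_eqE /=; lia. Qed.

Lemma gadj_black p q : ~~ white p -> gadj p q = (psub p q \in axdirs).
Proof. by rewrite /gadj => /negbTE ->; rewrite orbF. Qed.

Section Dimers.
Variable V : seq pt.
Local Notation T := (seq_sub V).

Definition tadj (a b : T) := gadj (val a) (val b).

(** The partner map is an involution, so sums over vertices can be reindexed along it. *)
Lemma dimer_mate (D : {set {set T}}) : dimer D -> exists f : {ffun T -> T},
  [/\ forall u, tadj u (f u), forall u, f (f u) = u
    & forall e, e \in D <-> exists u, e = [set u; f u]].
Proof.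
case/andP => /forallP Dedge /forallP Dcov.
have uniqD u : exists e, [set e in D | u \in e] = [set e].
  by have /eqP/eqP/cards1P := Dcov u.
have mate u : exists t, tadj u t && ([set u; t] \in D).
  have [e eE] := uniqD u; have : e \in [set e] by rewrite inE.
  rewrite -eE inE => /andP[eD ue].
  have /existsP[a /existsP[b /andP[/eqP eab ab]]] := implyP (Dedge e) eD.
  move: ue; rewrite eab !inE => /orP[] /eqP ->.
    by exists b; rewrite /tadj ab -eab.
  by exists a; rewrite /tadj gadjC ab setUC -eab.
have same u e e' : e \in D -> e' \in D -> u \in e -> u \in e' -> e = e'.
  move=> eD e'D ue ue'; have [e0 e0E] := uniqD u.
  have : e \in [set e0] by rewrite -e0E inE eD.
  have : e' \in [set e0] by rewrite -e0E inE e'D.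
  by rewrite !inE => /eqP -> /eqP ->.
have [f fP] := fin_all_exists mate.
have fD u : [set u; f u] \in D by have /andP[] := fP u.
exists (finfun f); split=> [u|u|e]; rewrite ?ffunE.
- by have /andP[] := fP u.
- have same_u : [set f u; f (f u)] = [set u; f u].
    by apply: (same (f u)); rewrite ?fD // !inE eqxx ?orbT.
  have : u \in [set f u; f (f u)] by rewrite same_u !inE eqxx.
  rewrite !inE => /orP[/eqP ufu|/eqP <- //].
  by have /andP[] := fP u; rewrite /tadj -ufu (negbTE (gadj_irr _)).
- split=> [eD|[u ->]]; last by rewrite ffunE.
  have /existsP[a /existsP[b /andP[/eqP eab ab]]] := implyP (Dedge e) eD.
  by exists a; rewrite ffunE; apply: (same a); rewrite ?fD // ?eab !inE eqxx.
Qed.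

Lemma mate_edge (D : {set {set T}}) (f : {ffun T -> T}) :
  (forall u, f (f u) = u) -> (forall e, e \in D <-> exists u, e = [set u; f u]) ->
  forall a b, a != b -> ([set a; b] \in D) = (f a == b).
Proof.
move=> ff fD a b ab; apply/idP/eqP => [/fD[u /setP eq_e]|<-]; last by apply/fD; exists a.
have := eq_e a; have := eq_e b; rewrite !inE !eqxx orbT /=.
case/esym/orP=> /eqP eb /esym/orP[] /eqP ea; move: ab; rewrite ea eb ?ff ?eqxx //.
Qed.

Section Count.
Variables (m : nat) (bn wn : 'I_m -> T) (v w : T).
Hypothesis T_enum :
  perm_eq (enum {: T}) ([seq bn i | i : 'I_m] ++ [seq wn i | i : 'I_m] ++ [:: v; w]).
Hypothesis bn_black : forall i, ~~ white (val (bn i)).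
Hypothesis wn_white : forall i, white (val (wn i)).
Hypothesis v_white : white (val v).
Hypothesis vw : psub (val v) (val w) \in diagdirs.

Local Notation compat := (compatible (fun i => val (bn i)) (fun i => val (wn i))).

Lemma T_case u : [\/ exists i, u = bn i, exists i, u = wn i, u = v | u = w].
Proof.
have := mem_enum {: T} u; rewrite (perm_mem T_enum) !mem_cat !inE.
case/or4P => [/imageP[i _ ->]|/imageP[i _ ->]|/eqP ->|/eqP ->].
- by apply: Or41; exists i.
- by apply: Or42; exists i.
- exact: Or43.
- exact: Or44.
Qed.

Lemma V_enumT : uniq V -> perm_eq V
  ([seq val (bn i) | i : 'I_m] ++ [seq val (wn i) | i : 'I_m] ++ [:: val v; val w]).
Proof.
move=> uV; apply: (@perm_trans _ (map val (enum {: T}))); last first.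
  by have := perm_map val T_enum; rewrite /image_mem !map_cat -!map_comp.
apply: uniq_perm => //; first by rewrite map_inj_uniq ?enum_uniq //; apply: val_inj.
move=> p; apply/idP/mapP => [pV|[u _ ->]]; last exact: valP.
by exists (SeqSub pV); rewrite ?mem_enum.
Qed.

Lemma T_matching : [/\ injective bn, injective wn, forall i, wn i != v & forall i, wn i != w].
Proof.
have := enum_uniq {: T}; rewrite (perm_uniq T_enum) !cat_uniq => /and3P[ub _ /and3P[uw hvw _]].
have notin i u : u \in [:: v; w] -> wn i != u.
  move=> uvw; apply: contra hvw => /eqP eq_u; apply/hasP; exists u => //=.
  by rewrite -eq_u image_f.
by split=> [||i|i]; [exact/injectiveP | exact/injectiveP | |]; apply: notin; rewrite !inE eqxx ?orbT.
Qed.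

Lemma bn_neq_white i u : white (val u) -> bn i != u.
Proof. by apply: contraTneq => <-; apply: bn_black. Qed.

Lemma w_white : white (val w).
Proof.
move: v_white vw; rewrite /white /evenz /psub !inE !xpair_eqE.
by case: (val v) (val w) => x y [x' y'] /=; lia.
Qed.

Lemma v_neq_w : v != w.
Proof. by apply: contraTneq vw => ->; case: (val w) => x y; rewrite /psub /= !subrr. Qed.

Definition matching_edges (s : 'S_m) : {set {set T}} :=
  [set v; w] |: [set [set bn i; wn (s i)] | i : 'I_m].

Lemma matching_edges_dimer s : compat s -> dimer (matching_edges s).
Proof.
move=> cs; have [bn_inj wn_inj wn_v wn_w] := T_matching.
have vwg : gadj (val v) (val w) by rewrite /gadj v_white w_white vw orbT.
apply/andP; split.
  apply/forallP => e; apply/implyP; case/setU1P => [->|/imsetP[i _ ->]].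
    by apply/existsP; exists v; apply/existsP; exists w; rewrite eqxx.
  apply/existsP; exists (bn i); apply/existsP; exists (wn (s i)).
  by rewrite eqxx /gadj psubC_axdirs cs.
have bw i j : (wn j == bn i) = false by rewrite eq_sym; apply/negbTE/bn_neq_white.
have vb i : (v == bn i) = false by rewrite eq_sym; apply/negbTE/bn_neq_white.
have wb i : (w == bn i) = false by rewrite eq_sym; apply/negbTE/bn_neq_white/w_white.
have bv i : (bn i == v) = false by apply/negbTE/bn_neq_white.
have bw' i : (bn i == w) = false by apply/negbTE/bn_neq_white/w_white.
have bw2 i j : (bn i == wn j) = false by apply/negbTE/bn_neq_white.
have wv i : (wn i == v) = false by apply/negbTE.
have ww i : (wn i == w) = false by apply/negbTE.
have vwn i : (v == wn i) = false by rewrite eq_sym.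
have wwn i : (w == wn i) = false by rewrite eq_sym.
apply/forallP => u; apply/cards1P.
have only i (e : {set T}) : (bn i \in e) || (wn (s i) \in e) ->
    e \in matching_edges s -> e = [set bn i; wn (s i)].
  move=> ie /setU1P[eE|/imsetP[j _ eE]]; move: ie; rewrite eE !inE.
    by rewrite bv bw' wv ww.
  rewrite bw bw2 orbF !(inj_eq bn_inj) !(inj_eq wn_inj) (inj_eq perm_inj).
  by rewrite orbb => /eqP ->.
have onlyv (e : {set T}) : (v \in e) || (w \in e) ->
    e \in matching_edges s -> e = [set v; w].
  move=> ie /setU1P[//|/imsetP[j _ eE]]; move: ie; rewrite eE !inE.
  by rewrite vb wb vwn wwn.
have ein i : [set bn i; wn (s i)] \in matching_edges s by apply/setU1P; right; apply/imsetP; exists i.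
have vin : [set v; w] \in matching_edges s by apply/setU1P; left.
case: (T_case u) => [[i ->]|[i ->]|->|->].
- exists [set bn i; wn (s i)]; apply/setP => e; rewrite inE in_set1.
  apply/andP/eqP => [[eD ie]|->]; first by apply: only; rewrite ?ie.
  by rewrite ein !inE eqxx.
- rewrite -(permKV s i); set j := (s^-1)%g i.
  exists [set bn j; wn (s j)]; apply/setP => e; rewrite inE in_set1.
  apply/andP/eqP => [[eD ie]|->]; first by apply: only; rewrite ?ie ?orbT.
  by rewrite ein !inE eqxx orbT.
- exists [set v; w]; apply/setP => e; rewrite inE in_set1.
  apply/andP/eqP => [[eD ie]|->]; first by apply: onlyv; rewrite ?ie.
  by rewrite vin !inE eqxx.
- exists [set v; w]; apply/setP => e; rewrite inE in_set1.
  apply/andP/eqP => [[eD ie]|->]; first by apply: onlyv; rewrite ?ie ?orbT.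
  by rewrite vin !inE eqxx orbT.
Qed.

Lemma matching_edges_inj : injective matching_edges.
Proof.
move=> s s' eq_ss; apply/permP => i; have [bn_inj wn_inj wn_v wn_w] := T_matching.
have : [set bn i; wn (s i)] \in matching_edges s by apply/setU1P; right; apply/imsetP; exists i.
rewrite eq_ss => /setU1P[/setP/(_ (bn i))|/imsetP[j _ /setP eq_e]].
  by rewrite !inE eqxx (negbTE (bn_neq_white _ v_white)) (negbTE (bn_neq_white _ w_white)).
have := eq_e (bn i); have := eq_e (wn (s i)); rewrite !inE !eqxx orbT /=.
rewrite (negbTE (bn_neq_white i (wn_white (s' j)))) [wn _ == bn _]eq_sym.
rewrite (negbTE (bn_neq_white j (wn_white (s i)))) orbF /=.
by move=> /esym/eqP/wn_inj-> /esym/eqP/bn_inj->.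
Qed.

(** As [v] and [w] are partners of each other, every black vertex has its partner among the [wn];
    this injection between sets of equal size is a permutation, which accounts for the whole
    covering. *)
Lemma dimer_matching (D : {set {set T}}) : dimer D -> [set v; w] \in D ->
  exists2 s, compat s & D = matching_edges s.
Proof.
move=> dD; have [f [fadj ff fD]] := dimer_mate dD.
rewrite (mate_edge ff fD v_neq_w) => /eqP fv.
have fw : f w = v by rewrite -fv ff.
have [bn_inj wn_inj wn_v wn_w] := T_matching.
have step i : psub (val (f (bn i))) (val (bn i)) \in axdirs.
  by have := fadj (bn i); rewrite /tadj gadj_black ?bn_black // psubC_axdirs.
have fbn i : exists j, f (bn i) = wn j.
  have fwhite : white (val (f (bn i))) by rewrite (axdirs_white (step i)) bn_black.
  case: (T_case (f (bn i))) => [[j e]|[j e]|e|e].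
  - by move: fwhite; rewrite e (negbTE (bn_black j)).
  - by exists j.
  - by have := bn_neq_white i w_white; rewrite -fv -e ff eqxx.
  - by have := bn_neq_white i v_white; rewrite -fw -e ff eqxx.
have [s0 s0P] := fin_all_exists fbn.
have s0_inj : injective s0.
  by move=> i j eq_s; apply/bn_inj/(can_inj ff); rewrite !s0P eq_s.
exists (perm s0_inj) => [i|]; first by rewrite permE -s0P step.
have sE i : wn (perm s0_inj i) = f (bn i) by rewrite permE s0P.
apply/setP => e; apply/idP/setU1P => [/fD[u ->]|[->|/imsetP[i _ ->]]]; last first.
- by apply/fD; exists (bn i); rewrite sE.
- by apply/fD; exists v; rewrite fv.
case: (T_case u) => [[i ->]|[i ->]|->|->].
- by right; apply/imsetP; exists i; rewrite ?sE.
- right; apply/imsetP; exists ((perm s0_inj)^-1 i)%g; rewrite // sE setUC.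
  have -> : wn i = f (bn ((perm s0_inj)^-1 i)%g) by rewrite -sE permKV.
  by rewrite ff.
- by left; rewrite fv.
- by left; rewrite fw setUC.
Qed.

Lemma card_dimer_matching :
  #|[set D : {set {set T}} | dimer D && ([set v; w] \in D)]|
  = #|[set s : 'S_m | [forall i, psub (val (wn (s i))) (val (bn i)) \in axdirs]]|.
Proof.
rewrite -(card_imset _ matching_edges_inj); congr #|pred_of_set _|; apply/setP => D.
rewrite inE; apply/andP/imsetP => [[dD vwD]|[s]].
  by have [s cs ->] := dimer_matching dD vwD; exists s; rewrite // inE; apply/forallP.
rewrite inE => /forallP cs ->; split; first exact: matching_edges_dimer.
by rewrite !inE eqxx.
Qed.

(** The nonzero terms of the Leibniz expansion correspond to the coverings and have equal signs by
    [matching_sign], so nothing cancels. *)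
Lemma card_dimer_det : uniq V -> connected_in (predC (mem V)) gadj ->
  #|[set D : {set {set T}} | dimer D && ([set v; w] \in D)]|%:R
  = `|\det (\matrix_(i, j) kast (val (bn i)) (val (wn j)))|.
Proof.
move=> uV conn; rewrite card_dimer_matching /determinant; set S := [set s | _].
under eq_bigr do under eq_bigr do rewrite mxE.
have zero s : s \notin S -> (-1) ^+ s * \prod_i kast (val (bn i)) (val (wn (s i))) = 0.
  rewrite inE => /forallPn[i ni]; rewrite (bigD1 i) //= /kast psubC_axdirs (negbTE ni).
  by rewrite mul0r mulr0.
rewrite (bigID (mem S)) /= [X in _ + X]big1 ?addr0 => [|s /zero //].
have [->|[s0 s0S]] := set_0Vmem S; first by rewrite cards0 big_set0 normr0.
have cS s : s \in S -> compat s by rewrite inE => /forallP.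
rewrite (eq_bigr (fun=> (-1) ^+ s0 * \prod_i kast (val (bn i)) (val (wn (s0 i))))) => [|s sS].
  rewrite sumr_const normrMn normrM normrX normrN1 expr1n mul1r normr_prod big1 // => i _.
  by rewrite /kast psubC_axdirs (cS _ s0S) normrX normrN1 expr1n.
apply: (matching_sign conn uV (V_enumT uV)) => //; exact: cS.
Qed.

End Count.
End Dimers.

(** * The Kasteleyn operator as a square root of the Laplacian *)

Definition even2 (p : pt) : bool := evenz p.1 && evenz p.2.

Lemma psub_padd p d : psub (padd p d) p = d.
Proof. by case: p d => x y [z t]; rewrite /psub /padd /=; congr pair; ring. Qed.

Lemma kast_step p d : d \in axdirs -> kast p (padd p d) =
  (-1) ^+ (half_par p (+) half_par (padd p d) (+) (par p.1 && (d.1 == 0))).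
Proof.
move=> dax; rewrite /kast psubC_axdirs.
by rewrite psub_padd dax (_ : (p.1 == (padd p d).1) = (d.1 == 0)) //; rewrite /padd /=; lia.
Qed.

Lemma white_padd p d : d \in axdirs -> white (padd p d) = ~~ white p.
Proof. by move=> dax; apply: axdirs_white; rewrite psub_padd. Qed.

Lemma half_par_shift p d : d \in axdirs ->
  half_par (padd p (padd d d)) = ~~ half_par p.
Proof.
case: p d => x y [d1 d2]; rewrite !inE.
by case/or4P=> /eqP[-> ->]; rewrite /half_par /white /par /evenz /padd /=; lia.
Qed.

Definition opp_pt (d : pt) : pt := (- d.1, - d.2).

(** The purpose of the gauge: opposite edges at a vertex have opposite signs, so the operator takes
    differences along each axis. *)
Lemma kast_opp p d : d \in axdirs -> kast p (padd p (opp_pt d)) = - kast p (padd p d).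
Proof.
move=> dax; have dax' : opp_pt d \in axdirs.
  by move: dax; case: d => x y; rewrite !inE => /or4P[] /eqP[-> ->].
rewrite !kast_step // oppr_eq0.
have -> : half_par (padd p d) = ~~ half_par (padd p (opp_pt d)).
  rewrite -(half_par_shift _ dax); congr half_par.
  by case: p d {dax dax'} => x y [z t]; congr pair; rewrite /=; ring.
by rewrite addbN addNb signrN opprK.
Qed.

Lemma kast_straight p d : d \in axdirs ->
  kast p (padd p d) * kast (padd p d) (padd (padd p d) d) = -1.
Proof.
move=> dax; rewrite [kast _ (padd (padd p d) d)](_ : _ = - kast (padd p d) p).
  by rewrite mulrN [X in _ * X]kastC kast_sqr // psubC_axdirs psub_padd.
have -> : kast (padd p d) p = kast (padd p d) (padd (padd p d) (opp_pt d)).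
  by congr kast; case: p d {dax} => x y [z t]; congr pair; rewrite /=; ring.
by rewrite kast_opp // opprK.
Qed.

Lemma par_padd p d : d \in axdirs -> par (padd p d).1 = par p.1 (+) (d.1 != 0).
Proof.
by case: p d => x y [z t]; rewrite !inE => /or4P[] /eqP[-> _]; rewrite /par /evenz /=; lia.
Qed.

(** Kasteleyn's condition: the four signs around a unit square have product -1. *)
Lemma kast_square p d d' : d \in axdirs -> d' \in axdirs -> (d.1 == 0) != (d'.1 == 0) ->
  kast p (padd p d) * kast (padd p d) (padd (padd p d) d')
  = - (kast p (padd p d') * kast (padd p d') (padd (padd p d') d)).
Proof.
move=> dax dax' orth; rewrite !kast_step // -!signr_addb.
have -> : padd (padd p d') d = padd (padd p d) d'.
  by case: p d d' {dax dax' orth} => x y [z t] [z2 t2]; congr pair; rewrite /=; ring.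
rewrite !par_padd // -signrN; congr (_ ^+ nat_of_bool _); move: orth.
by case: (d.1 == 0); case: (d'.1 == 0) => //= _; case: (par _); case: (half_par p);
  case: (half_par (padd p d)); case: (half_par (padd p d')); case: (half_par _).
Qed.

(** The Kasteleyn matrix as an operator on functions on the whole lattice, a discrete Dirac operator
    exchanging white and black vertices. *)
Definition ksum (f : pt -> rat) (p : pt) : rat :=
  \sum_(d <- axdirs) kast p (padd p d) * f (padd p d).

Lemma ksumD f g p : ksum (fun q => f q + g q) p = ksum f p + ksum g p.
Proof. by rewrite /ksum -big_split; apply: eq_bigr => d _; rewrite mulrDr. Qed.

(* The Kasteleyn signs square to the Laplacian of the two sublattices: the paths through the two
   corners of a lattice square cancel. *)
Lemma ksum_ksum f p :
  ksum (ksum f) p = 4 * f p - \sum_(d <- axdirs2) f (padd p d).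
Proof.
pose t d d' : rat := kast p (padd p d) * kast (padd p d) (padd (padd p d) d').
have E1 : ksum (ksum f) p =
    \sum_(d <- axdirs) \sum_(d' <- axdirs) t d d' * f (padd (padd p d) d').
  by apply: eq_bigr => d _; rewrite mulr_sumr; apply: eq_bigr => d' _; rewrite mulrA.
have S d : d \in axdirs -> t d d = -1 by move=> dax; apply: kast_straight.
have B d : d \in axdirs -> t d (opp_pt d) = 1.
  move=> dax; rewrite /t kast_opp // mulrN -[kast p _ * _]/(t d d) S // opprK //.
have Q d d' : d \in axdirs -> d' \in axdirs -> (d.1 == 0) != (d'.1 == 0) -> t d d' = - t d' d.
  exact: kast_square.
rewrite E1 /axdirs /axdirs2 !big_cons !big_nil.
have B1 : t (1, 0) (-1, 0) = 1 := B (1, 0) isT.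
have B2 : t (-1, 0) (1, 0) = 1 := B (-1, 0) isT.
have B3 : t (0, 1) (0, -1) = 1 := B (0, 1) isT.
have B4 : t (0, -1) (0, 1) = 1 := B (0, -1) isT.
rewrite !S // B1 B2 B3 B4.
rewrite (Q (0, 1) (1, 0)) // (Q (0, 1) (-1, 0)) // (Q (0, -1) (1, 0)) // (Q (0, -1) (-1, 0)) //.
have e (q r : pt) : q.1 = r.1 -> q.2 = r.2 -> f q = f r.
  by case: q r => ? ? [? ?] /= -> ->.
case: p {E1 S B Q B1 B2 B3 B4} t => x y t; rewrite /padd /=.
rewrite (_ : x + 1 + 1 = x + 2); last by ring.
rewrite (_ : x - 1 - 1 = x - 2); last by ring.
rewrite (_ : y + 1 + 1 = y + 2); last by ring.
rewrite (_ : y - 1 - 1 = y - 2); last by ring.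
rewrite ?addr0 ?addrK ?subrK; ring.
Qed.

(** * Invertibility of the Kasteleyn matrix *)

Lemma white_even2 p : white p = even2 p || inW1 p.
Proof. by case: p => x y; rewrite /white /even2 /inW1 /evenz /=; lia. Qed.

Lemma opp_axdirs d : d \in axdirs -> opp_pt d \in axdirs.
Proof. by case: d => x y; rewrite !inE => /or4P[] /eqP[-> ->]. Qed.

Lemma opp_diagdirs d : d \in diagdirs -> opp_pt d \in diagdirs.
Proof. by case: d => x y; rewrite !inE => /or4P[] /eqP[-> ->]. Qed.

Lemma padd_opp p d : padd (padd p d) (opp_pt d) = p.
Proof. by case: p d => x y [z t]; rewrite /padd /=; congr pair; ring. Qed.

Lemma padd_inE (F dirs : seq pt) p : (forall d, d \in dirs -> opp_pt d \in dirs) ->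
  (p \in [seq padd c d | c <- F, d <- dirs]) = has (fun d => padd p d \in F) dirs.
Proof.
move=> oppd; apply/allpairsP/hasP => [[[c d] /= [cF dd ->]]|[d dd pF]].
  by exists (opp_pt d); rewrite ?oppd // padd_opp.
by exists (padd p d, opp_pt d); rewrite padd_opp /= pF oppd.
Qed.

Lemma cornersE F p : (p \in cornersH F) = has (fun d => padd p d \in F) diagdirs.
Proof. exact: padd_inE opp_diagdirs. Qed.

Lemma midsE F p : (p \in midsH F) = has (fun d => padd p d \in F) axdirs.
Proof. exact: padd_inE opp_axdirs. Qed.

Lemma even2_diag p d : d \in diagdirs -> inW1 (padd p d) = even2 p.
Proof.
by case: p d => x y [z t]; rewrite !inE => /or4P[] /eqP[-> ->];
  rewrite /inW1 /even2 /padd /evenz /=; lia.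
Qed.

Lemma diag_even2 p d : d \in diagdirs -> even2 (padd p d) = inW1 p.
Proof.
by case: p d => x y [z t]; rewrite !inE => /or4P[] /eqP[-> ->];
  rewrite /inW1 /even2 /padd /evenz /=; lia.
Qed.

Lemma psub_dirs (p q : pt) : padd q (psub p q) = p.
Proof. by case: p q => x y [z t]; rewrite /padd /psub /=; congr pair; ring. Qed.

(** A midpoint lies on a side of a face of [F], and both ends of that side are corners of the face;
    [psub d' d] points from the end to the face centre. *)
Lemma mid_corner F p d : all inW1 F -> p \in midsH F -> d \in axdirs -> even2 (padd p d) ->
  padd p d \in cornersH F.
Proof.
move=> hFW1; rewrite midsE cornersE => /hasP[d' dd' pF] dd p0; have := allP hFW1 _ pF => W1.
apply/hasP; exists (psub d' d).
  move: p0 W1 dd dd'; case: p d d' {pF} => x y [z t] [z' t']; rewrite !inE /psub /inW1 /even2 /evenz /=.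
  by move=> p0 W1 /or4P[] /eqP[? ?] /or4P[] /eqP[? ?]; subst; rewrite !xpair_eqE; lia.
by move: pF; congr (_ \in F); case: p d d' {W1 p0 dd dd'} => x y [z t] [z' t'];
  rewrite /padd /psub /=; congr pair; ring.
Qed.

Section VGfacts.
Variables (F : seq pt) (fs : pt).
Hypothesis hFW1 : all inW1 F.
Hypothesis hfsW1 : inW1 fs.

Lemma memVG p : (p \in VG F fs) = [|| p \in cornersH F, p == fs, p \in F | p \in midsH F].
Proof. by rewrite mem_undup !mem_cat in_cons -orbA. Qed.

Lemma corner_even2 p : p \in cornersH F -> even2 p.
Proof. by rewrite cornersE => /hasP[d dd /(allP hFW1)]; rewrite even2_diag. Qed.

Lemma mid_black p : p \in midsH F -> ~~ white p.
Proof.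
rewrite midsE => /hasP[d dd /(allP hFW1) W1]; rewrite -(white_padd p dd) white_even2 W1 orbT //.
Qed.

Lemma inW1_even2 p : inW1 p -> even2 p = false.
Proof. by rewrite /inW1 /even2 => /andP[/negbTE->]. Qed.

Lemma VG_black p : ~~ white p -> (p \in VG F fs) = (p \in midsH F).
Proof.
rewrite memVG white_even2 negb_or => /andP[/negbTE p0 /negbTE p1].
have -> : (p \in cornersH F) = false by apply: contraFF p0; apply: corner_even2.
have -> : (p \in F) = false by apply: contraFF p1; exact: (allP hFW1).
by have -> : (p == fs) = false by apply: contraFF p1 => /eqP->.
Qed.

Lemma VG_even2 p : even2 p -> (p \in VG F fs) = (p \in cornersH F).
Proof.
move=> p0; have p1 : inW1 p = false by apply: contraTF p0 => /inW1_even2->.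
have pw : white p by rewrite white_even2 p0.
rewrite memVG; have -> : (p \in F) = false by apply: contraFF p1; exact: (allP hFW1).
have -> : (p == fs) = false by apply: contraFF p1 => /eqP->.
have -> : (p \in midsH F) = false by apply: contraTF pw => /mid_black.
by rewrite !orbF.
Qed.

Lemma VG_inW1 p : inW1 p -> (p \in VG F fs) = (p == fs) || (p \in F).
Proof.
move=> p1; have pw : white p by rewrite white_even2 p1 orbT.
rewrite memVG.
have -> : (p \in cornersH F) = false.
  by apply: contraTF p1 => /corner_even2; apply: contraTN => /inW1_even2->.
have -> : (p \in midsH F) = false by apply: contraTF pw => /mid_black.
by rewrite orbF.
Qed.

Lemma face_mid c d : c \in F -> d \in axdirs -> padd c d \in midsH F.
Proof.
by move=> cF dd; rewrite midsE; apply/hasP; exists (opp_pt d); rewrite ?opp_axdirs ?padd_opp.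
Qed.

Lemma face_corner c d : c \in F -> d \in diagdirs -> padd c d \in cornersH F.
Proof.
by move=> cF dd; rewrite cornersE; apply/hasP; exists (opp_pt d); rewrite ?opp_diagdirs ?padd_opp.
Qed.

End VGfacts.

Lemma sum_seq_sub (V : seq pt) (Z : nmodType) (h : pt -> Z) : uniq V ->
  \sum_(u : seq_sub V) h (val u) = \sum_(q <- V) h q.
Proof.
move=> uV; rewrite -big_enum -(big_map val xpredT h); apply/perm_big/uniq_perm => //.
  by rewrite map_inj_uniq ?enum_uniq //; apply: val_inj.
move=> p; apply/mapP/idP => [[u _ ->]|pV]; first exact: valP.
by exists (SeqSub pV); rewrite ?mem_enum.
Qed.

Lemma sum_kast (V : seq pt) p (f : pt -> rat) : uniq V -> (forall q, q \notin V -> f q = 0) ->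
  \sum_(q <- V) kast p q * f q = ksum f p.
Proof.
move=> uV f0; rewrite /ksum -(big_map (padd p) xpredT (fun q => kast p q * f q)).
apply: big_seq_support => //.
  by rewrite map_inj_uniq // => d d' /(congr1 (psub^~ p)); rewrite !psub_padd.
move=> q; rewrite mulf_eq0 negb_or => /andP[Kq fq].
apply/andP; split; first by apply: contraNT fq => /f0->.
apply/mapP; exists (psub q p); last by rewrite psub_dirs.
by apply: contraNT Kq; rewrite /kast psubC_axdirs => /negbTE->.
Qed.

(** At a vertex of Lambda the operator is minus the divergence of a flow oriented to the right and
    upwards. At midpoints, [ksum_hmid] and [ksum_vmid] give the gradient of the vertex part along
    the edge plus the difference of the face part across it. *)
Lemma ksum_even2 (f : pt -> rat) (x y : int) : ksum f (2 * x, 2 * y) =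
  - f (2 * x + 1, 2 * y) + f (2 * x - 1, 2 * y) - f (2 * x, 2 * y + 1) + f (2 * x, 2 * y - 1).
Proof.
rewrite /ksum /axdirs !big_cons big_nil !kast_step //= /padd /= !addr0.
have -> : half_par (2 * x, 2 * y) = par x (+) par y by rewrite /half_par /white /par /evenz /=; lia.
have -> : half_par (2 * x + 1, 2 * y) = ~~ (par x (+) par y) by rewrite /half_par /white /par /evenz /=; lia.
have -> : half_par (2 * x - 1, 2 * y) = par x (+) par y by rewrite /half_par /white /par /evenz /=; lia.
have -> : half_par (2 * x, 2 * y + 1) = ~~ (par x (+) par y) by rewrite /half_par /white /par /evenz /=; lia.
have -> : half_par (2 * x, 2 * y - 1) = par x (+) par y by rewrite /half_par /white /par /evenz /=; lia.
have -> : par (2 * x) = false by rewrite /par /evenz; lia.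
by case: (par x (+) par y); rewrite /= ?expr1 ?expr0; ring.
Qed.

Lemma ksum_hmid (f : pt -> rat) (x y : int) : ksum f (2 * x + 1, 2 * y) =
  f (2 * x + 2, 2 * y) - f (2 * x, 2 * y) + f (2 * x + 1, 2 * y + 1) - f (2 * x + 1, 2 * y - 1).
Proof.
rewrite /ksum /axdirs !big_cons big_nil !kast_step //= /padd /= !addr0 addrK.
rewrite (_ : 2 * x + 1 + 1 = 2 * x + 2); last by ring.
have -> : half_par (2 * x + 1, 2 * y) = ~~ (par x (+) par y) by rewrite /half_par /white /par /evenz /=; lia.
have -> : half_par (2 * x, 2 * y) = par x (+) par y by rewrite /half_par /white /par /evenz /=; lia.
have -> : half_par (2 * x + 2, 2 * y) = ~~ (par x (+) par y) by rewrite /half_par /white /par /evenz /=; lia.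
have -> : half_par (2 * x + 1, 2 * y + 1) = par x (+) par y by rewrite /half_par /white /par /evenz /=; lia.
have -> : half_par (2 * x + 1, 2 * y - 1) = ~~ (par x (+) par y) by rewrite /half_par /white /par /evenz /=; lia.
have -> : par (2 * x + 1) = true by rewrite /par /evenz; lia.
by case: (par x (+) par y); rewrite /= ?expr1 ?expr0; ring.
Qed.

Lemma ksum_vmid (f : pt -> rat) (x y : int) : ksum f (2 * x, 2 * y + 1) =
  f (2 * x, 2 * y + 2) - f (2 * x, 2 * y) + f (2 * x - 1, 2 * y + 1) - f (2 * x + 1, 2 * y + 1).
Proof.
rewrite /ksum /axdirs !big_cons big_nil !kast_step //= /padd /= !addr0 addrK.
rewrite (_ : 2 * y + 1 + 1 = 2 * y + 2); last by ring.
have -> : half_par (2 * x, 2 * y + 1) = ~~ (par x (+) par y) by rewrite /half_par /white /par /evenz /=; lia.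
have -> : half_par (2 * x, 2 * y) = par x (+) par y by rewrite /half_par /white /par /evenz /=; lia.
have -> : half_par (2 * x, 2 * y + 2) = ~~ (par x (+) par y) by rewrite /half_par /white /par /evenz /=; lia.
have -> : half_par (2 * x + 1, 2 * y + 1) = par x (+) par y by rewrite /half_par /white /par /evenz /=; lia.
have -> : half_par (2 * x - 1, 2 * y + 1) = ~~ (par x (+) par y) by rewrite /half_par /white /par /evenz /=; lia.
have -> : par (2 * x) = false by rewrite /par /evenz; lia.
by case: (par x (+) par y); rewrite /= ?expr1 ?expr0; ring.
Qed.

Lemma evenz_double (x : int) : evenz (2 * x). Proof. by rewrite /evenz; lia. Qed.
Lemma evenz_succ (x : int) : evenz (2 * x + 1) = false. Proof. by rewrite /evenz; lia. Qed.
Lemma evenz_pred (x : int) : evenz (2 * x - 1) = false. Proof. by rewrite /evenz; lia. Qed.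
Lemma evenz_double_succ (x : int) : evenz (2 * x + 2). Proof. by rewrite /evenz; lia. Qed.
Definition evenzE := (evenz_double, evenz_succ, evenz_pred, evenz_double_succ).

Lemma inW1_coord p : inW1 p -> exists x y : int, p = (2 * x + 1, 2 * y + 1).
Proof.
case: p => x y; rewrite /inW1 /evenz /= => e; exists (x %/ 2)%Z, (y %/ 2)%Z; congr pair; lia.
Qed.

Lemma black_coord p : ~~ white p ->
  (exists x y : int, p = (2 * x + 1, 2 * y)) \/ (exists x y : int, p = (2 * x, 2 * y + 1)).
Proof.
case: p => x y; rewrite /white /evenz /= => e.
case xe: (2 %| x)%Z; [right | left]; exists (x %/ 2)%Z, (y %/ 2)%Z; congr pair; lia.
Qed.

(** Summation by parts: the signs are symmetric, so the operator is self-adjoint. *)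
Lemma ksum_duality (V : seq pt) (f g : pt -> rat) : uniq V ->
  (forall q, q \notin V -> f q = 0) -> (forall q, q \notin V -> g q = 0) ->
  \sum_(a <- V) f a * ksum g a = \sum_(b <- V) g b * ksum f b.
Proof.
move=> uV f0 g0.
under eq_bigr do rewrite -(sum_kast _ uV g0) mulr_sumr.
rewrite exchange_big; apply: eq_bigr => b _.
rewrite -(sum_kast _ uV f0) mulr_sumr; apply: eq_bigr => a _.
by rewrite kastC mulrCA [f a * _]mulrC mulrCA mulrA -mulrA.
Qed.

Lemma sum_sqr_eq0 (V : seq pt) (g : pt -> rat) :
  \sum_(b <- V) g b * g b = 0 -> forall b, b \in V -> g b = 0.
Proof.
move/eqP; rewrite psumr_eq0 => [/allP g0 b /g0|b _]; last by rewrite -expr2 sqr_ge0.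
by rewrite /= mulf_eq0 orbb => /eqP.
Qed.

(** Of the four axis neighbours of [q] only [c] and [padd q d] lie in W1, so no other face can have
    [q] on its side. *)
Lemma mid_between F c d q : all inW1 F -> inW1 c -> d \in axdirs -> q = padd c d ->
  c \notin F -> padd q d \notin F -> q \notin midsH F.
Proof.
move=> hFW1 c1 dd qE cF cF'; rewrite midsE; apply/hasPn => d' dd'.
have [->//|d'_neq] := eqVneq d' d.
have [->|d'_neq2] := eqVneq d' (opp_pt d); first by rewrite qE padd_opp.
have : ~~ inW1 (padd q d').
  move: c1 dd dd' d'_neq d'_neq2; rewrite qE; case: c d d' {qE cF cF'} => x y [a b] [a' b'].
  rewrite /inW1 /opp_pt /padd !inE /=.
  case/andP=> x1 y1 /or4P[] /eqP[-> ->] /or4P[] /eqP[-> ->]; rewrite ?eqxx //= => _ _;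
  by rewrite ?addr0 negb_and !negbK; apply/orP; (left; by move: x1; rewrite /evenz; lia) ||
     (right; by move: y1; rewrite /evenz; lia).
by apply: contra => /(allP hFW1).
Qed.

Section Kernels.
Variables (F : seq pt) (fs : pt).
Hypothesis hFW1 : all inW1 F.
Hypothesis hfsW1 : inW1 fs.
Hypothesis hfsF : fs \notin F.
Let V := VG F fs.

Let V_uniq : uniq V := undup_uniq _.

Let midV p : p \in midsH F -> p \in V.
Proof. by move=> pm; rewrite memVG pm !orbT. Qed.

Let cornerV p : p \in cornersH F -> p \in V.
Proof. by move=> pm; rewrite memVG pm. Qed.

Let faceV p : p \in F -> p \in V.
Proof. by move=> pm; rewrite memVG pm !orbT. Qed.

Lemma ksum_corners b : b \in midsH F -> ksum (fun a => (a \in cornersH F)%:R) b = 0.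
Proof.
move=> bm; have corner d : d \in axdirs -> even2 (padd b d) -> padd b d \in cornersH F.
  by move=> dd de; apply: mid_corner.
have noc p : ~~ even2 p -> (p \in cornersH F) = false by apply: contraNF => /(corner_even2 hFW1).
have [[x [y e]]|[x [y e]]] := black_coord (mid_black hFW1 bm); subst b.
  have c1 := corner (1, 0) isT; have c2 := corner (-1, 0) isT.
  rewrite /padd /even2 /= ?addr0 ?addrK -?addrA !evenzE in c1 c2.
  by rewrite ksum_hmid c1 ?c2 ?noc ?subrr ?subr0 // /even2 /= !evenzE.
have c1 := corner (0, 1) isT; have c2 := corner (0, -1) isT.
rewrite /padd /even2 /= ?addr0 ?addrK -?addrA !evenzE in c1 c2.
rewrite ksum_vmid c1 ?c2 ?noc ?subrr ?subr0 // /even2 /= !evenzE //.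
Qed.

Section Left.
Hypothesis hFc : connected_in [pred x | inW1 x && (x \notin F)] lamadj.
Variables (w : pt) (X : pt -> rat).
Hypothesis wV : w \in cornersH F.
Hypothesis X0 : forall p, p \notin midsH F -> X p = 0.
Hypothesis X_div : forall a, a \in cornersH F -> a != w -> ksum X a = 0.
Hypothesis X_curl : forall c, c \in F -> ksum X c = 0.

(* A vector in the left kernel is a divergence-free flow on the edges of H; its stream function vanishes
   off F because the complement of F is connected, and is harmonic on F. *)
Lemma left_kernel p : X p = 0.
Proof.
have X0V q : q \notin V -> X q = 0 by move=> qV; apply: X0; apply: contra qV; apply: midV.
have c0V q : q \notin V -> (q \in cornersH F)%:R = 0 :> rat.
  by move=> qV; rewrite (negbTE (contra (@cornerV q) qV)).
(* The indicator of the corners is annihilated at the midpoints, so by duality the total divergence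
   is zero, and the only value not prescribed, at [w], vanishes too. *)
have div_w : ksum X w = 0.
  have := ksum_duality V_uniq c0V X0V; rewrite (bigD1_seq w) ?cornerV //= wV mul1r big1 ?addr0.
    move=> ->; apply: big1 => b _; case bm : (b \in midsH F); first by rewrite ksum_corners ?mulr0.
    by rewrite X0 ?bm ?mul0r.
  by move=> a aw; case ac : (a \in cornersH F); rewrite ?mul0r // X_div ?mulr0.
have div a : even2 a -> ksum X a = 0.
  move=> a0; case ac: (a \in cornersH F).
    by have [->|/(X_div ac)] := eqVneq a w.
  rewrite /ksum big_seq big1 // => d dd; rewrite X0 ?mulr0 //.
  apply: contraFN ac => ad; rewrite -(padd_opp a d); apply: mid_corner => //.
    exact: opp_axdirs.
  by rewrite padd_opp.
have [N FN] := seq_bounded V.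
(* In halved coordinates [X] is a flow along the edges of Lambda, and [s] lives on the faces of
   Lambda. *)
have [s [sU sR s0]] : exists s : int -> int -> rat,
    [/\ forall x y : int, s (x - 1) y - s x y = X (2 * x, 2 * y + 1),
        forall x y : int, s x y - s x (y - 1) = X (2 * x + 1, 2 * y)
      & forall x y : int, `|N| <= x -> s x y = 0].
  apply: flow_potential => x y.
    by move=> Nx; split; apply: X0V; apply/negP => /FN /=; lia.
  have e1 : 2 * (x - 1) + 1 = 2 * x - 1 by lia.
  have e2 : 2 * (y - 1) + 1 = 2 * y - 1 by lia.
  have := div (2 * x, 2 * y); rewrite ksum_even2 e1 e2.
  have -> : even2 (2 * x, 2 * y) by rewrite /even2 /= !evenzE.
  by move=> /(_ isT) d0; lra.
pose S (c : pt) := s (c.1 %/ 2)%Z (c.2 %/ 2)%Z.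
have SE x y : S (2 * x + 1, 2 * y + 1) = s x y by rewrite /S /=; congr s; lia.
(* The edge separating two faces off [F] does not belong to H and carries no flow. *)
have S_step c c' : lamadj c c' -> c \notin F -> c' \notin F -> S c = S c'.
  case/and3P => /inW1_coord[x [y ->]] /inW1_coord[x' [y' ->]] st cF cF'.
  have Xnot q (d : pt) : d \in axdirs -> q = padd (2 * x + 1, 2 * y + 1) d ->
      padd q d = (2 * x' + 1, 2 * y' + 1) -> X q = 0.
    move=> dd dq dq'; apply/X0/(mid_between hFW1 _ dd dq cF); last by rewrite dq'.
    by rewrite /inW1 /= !evenzE.
  rewrite !SE; move: st; rewrite /psub !inE !xpair_eqE /=.
  case/or4P=> /andP[/eqP e1 /eqP e2].
  - have ? : x' = x - 1 by lia.
    have ? : y' = y by lia.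
    subst x' y'.
    by apply/esym/eqP; rewrite -subr_eq0 sU; apply/eqP/(Xnot _ (-1, 0)) => //;
      rewrite /padd /=; congr pair; ring.
  - have ? : x = x' - 1 by lia.
    have ? : y' = y by lia.
    subst x y'.
    by apply/eqP; rewrite -subr_eq0 sU; apply/eqP/(Xnot _ (1, 0)) => //;
      rewrite /padd /=; congr pair; ring.
  - have ? : y' = y - 1 by lia.
    have ? : x' = x by lia.
    subst y' x'.
    by apply/eqP; rewrite -subr_eq0 sR; apply/eqP/(Xnot _ (0, -1)) => //;
      rewrite /padd /=; congr pair; ring.
  - have ? : y = y' - 1 by lia.
    have ? : x' = x by lia.
    subst y x'.
    by apply/esym/eqP; rewrite -subr_eq0 sR; apply/eqP/(Xnot _ (0, 1)) => //;
      rewrite /padd /=; congr pair; ring.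
have S_out c : inW1 c -> c \notin F -> S c = 0.
  move=> c1 cF; pose c' : pt := (2 * `|N| + 1, 2 * 0 + 1).
  have c'F : c' \notin F by apply/negP => /faceV/FN /=; lia.
  have c'1 : inW1 c' by rewrite /inW1 /= !evenzE.
  have [l [lpath llast lall]] := hFc (x := c) (y := c') (introT andP (conj c1 cF)) (introT andP (conj c'1 c'F)).
  have <- : S c' = 0 by rewrite SE s0.
  rewrite -llast; elim: l c cF lpath lall {c1 llast} => //= r l IHl c cF /andP[cr rl].
  by case/andP=> /andP[_ rF] lF; rewrite -IHl //; apply: S_step.
pose St c := if c \in F then S c else 0.
have StE x y : St (2 * x + 1, 2 * y + 1) = s x y.
  rewrite /St; case: ifPn => [_|cF]; first exact: SE.
  by rewrite -SE S_out // /inW1 /= !evenzE.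
have St_even q : ~~ inW1 q -> St q = 0.
  by rewrite /St; case: ifP => // /(allP hFW1) ->.
have XE b : ~~ white b -> X b = ksum St b.
  case/black_coord => -[x [y ->]].
    rewrite ksum_hmid (_ : 2 * y - 1 = 2 * (y - 1) + 1); last by ring.
    by rewrite !StE !St_even ?subrr ?add0r ?sR // /inW1 /= !evenzE.
  rewrite ksum_vmid (_ : 2 * x - 1 = 2 * (x - 1) + 1); last by ring.
  by rewrite !StE !St_even ?subrr ?add0r ?sU // /inW1 /= !evenzE.
have St0V q : q \notin V -> St q = 0.
  by move=> qV; rewrite /St (negbTE (contra (@faceV q) qV)).
case pm : (p \in midsH F); last by rewrite X0 ?pm.
(* As [X = ksum St] on midpoints, duality turns the square norm of [X] into the pairing of [St] with
   [ksum X], which vanishes on [F]. *)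
apply: (@sum_sqr_eq0 V) (midV pm); rewrite -[RHS](_ : \sum_(c <- V) St c * ksum X c = 0).
  rewrite (ksum_duality V_uniq St0V X0V); apply: eq_bigr => b _.
  case bm : (b \in midsH F); first by rewrite -XE ?(mid_black hFW1).
  by rewrite X0 ?bm ?mul0r.
by apply: big1 => c _; rewrite /St; case: ifP => [/X_curl->|_]; rewrite ?mulr0 ?mul0r.
Qed.
End Left.
End Kernels.

Lemma axdirs2_inW1 p d : d \in axdirs2 -> inW1 (padd p d) = inW1 p.
Proof.
by case: p d => x y [z t]; rewrite !inE => /or4P[] /eqP[-> ->];
  rewrite /inW1 /padd /evenz /=; lia.
Qed.

Lemma eq_ksum f g p : f =1 g -> ksum f p = ksum g p.
Proof. by move=> fg; apply: eq_bigr => d _; rewrite fg. Qed.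

Lemma touch_corner c c' : touchadj c c' ->
  exists d d', [/\ d \in diagdirs, d' \in diagdirs & padd c d = padd c' d'].
Proof.
case: c c' => x y [x' y']; rewrite /touchadj /psub !inE !xpair_eqE /=.
have sol (a b a' b' : int) : (a, b) \in diagdirs -> (a', b') \in diagdirs ->
    x + a = x' + a' -> y + b = y' + b' ->
    exists d d', [/\ d \in diagdirs, d' \in diagdirs & padd (x, y) d = padd (x', y') d'].
  by move=> ? ? e e'; exists (a, b), (a', b'); split=> //; rewrite /padd /= e e'.
case/orP=> /or4P[] /andP[/eqP e1 /eqP e2].
- by apply: (sol (-1) 1 1 1) => //; lia.
- by apply: (sol 1 1 (-1) 1) => //; lia.
- by apply: (sol 1 (-1) 1 1) => //; lia.
- by apply: (sol 1 1 1 (-1)) => //; lia.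
- by apply: (sol (-1) (-1) 1 1) => //; lia.
- by apply: (sol 1 1 (-1) (-1)) => //; lia.
- by apply: (sol (-1) 1 1 (-1)) => //; lia.
- by apply: (sol 1 (-1) (-1) 1) => //; lia.
Qed.

Lemma connected_const (S : pred pt) (adj : rel pt) (A : Type) (g : pt -> A) :
  connected_in S adj -> (forall x y, S x -> S y -> adj x y -> g x = g y) ->
  forall x y, S x -> S y -> g x = g y.
Proof.
move=> conn step x y Sx Sy; have [l [lpath <- lall]] := conn x y Sx Sy.
elim: l x Sx lpath lall {y Sy} => //= r l IHl x Sx /andP[xr rl] /andP[Sr Sl].
by rewrite -(IHl r) //; apply: step.
Qed.

Section RightKernel.
Variables (F : seq pt) (fs : pt).
Hypothesis hFW1 : all inW1 F.
Hypothesis hFt : connected_in (mem F) touchadj.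
Variables (w : pt) (Y : pt -> rat).
Hypothesis wV : w \in cornersH F.
Hypothesis Y0 : forall p, p \notin cornersH F -> p \notin F -> Y p = 0.
Hypothesis Yw : Y w = 0.
Hypothesis Y_mid : forall b, b \in midsH F -> ksum Y b = 0.

Let Ye p := if even2 p then Y p else 0.
Let Yf p := if p \in F then Y p else 0.

Let YE p : Y p = Ye p + Yf p.
Proof.
rewrite /Ye /Yf; case: ifPn => p0.
  case: ifPn => [/(allP hFW1)/inW1_even2|_]; first by rewrite p0.
  by rewrite addr0.
case: ifPn => [_|pF]; rewrite add0r //; apply: Y0 => //.
by apply: contra p0; apply: corner_even2.
Qed.

(* The gradients of the vertex part and of the face part are orthogonal, so both vanish. *)
Let ksum_split b : b \in midsH F -> ksum Ye b = 0 /\ ksum Yf b = 0.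
Proof.
pose V := VG F fs; have uV : uniq V := undup_uniq _.
pose P b := if b \in midsH F then ksum Ye b else 0.
have P0 q : q \notin V -> P q = 0.
  by rewrite memVG !negb_or /P => /and4P[_ _ _ /negbTE->].
have Yf0 q : q \notin V -> Yf q = 0.
  by rewrite memVG !negb_or /Yf => /and4P[_ _ /negbTE-> _].
have sum_b d : d \in midsH F -> ksum Ye d + ksum Yf d = 0.
  by move=> dm; rewrite -ksumD -(Y_mid dm); apply: eq_ksum => q; rewrite -YE.
have orth : \sum_(b <- V) P b * ksum Yf b = 0.
  rewrite (ksum_duality uV P0 Yf0); apply: big1 => c _; rewrite /Yf.
  case: ifPn => cF; last by rewrite mul0r.
  have -> : ksum P c = ksum (ksum Ye) c.
    by apply: eq_big_seq => d dd; rewrite /P (face_mid cF dd).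
  have W1 := allP hFW1 _ cF.
  (* The Laplacian does not mix the two sublattices, and [Ye] is zero on W1. *)
  rewrite ksum_ksum /Ye inW1_even2 // mulr0 big_seq big1 ?subr0 ?mulr0 // => d dd.
  by rewrite inW1_even2 // axdirs2_inW1.
have sq : \sum_(b <- V) P b * P b = 0.
  transitivity (- \sum_(b <- V) P b * ksum Yf b); last by rewrite orth oppr0.
  rewrite -sumrN; apply: eq_bigr => d _; rewrite /P.
  case: ifPn => dm; last by rewrite !mul0r oppr0.
  by rewrite -mulrN; congr (_ * _); have := sum_b d dm; lra.
move=> bm; have : P b = 0 by apply: (sum_sqr_eq0 sq); rewrite memVG bm !orbT.
by rewrite /P bm => Pb; split=> //; have := sum_b b bm; rewrite Pb add0r.
Qed.

(** By [ksum_split] the vertex part has zero gradient along the four sides of the face. *)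
Lemma corner_const c d : c \in F -> d \in diagdirs -> Y (padd c d) = Y (padd c (1, 1)).
Proof.
move=> cF dd.
have YYe d' : d' \in diagdirs -> Y (padd c d') = Ye (padd c d').
  by move=> dd'; rewrite /Ye diag_even2 // (allP hFW1).
rewrite !YYe // {YYe}; have [x [y cE]] := inW1_coord (allP hFW1 _ cF).
have mid d' : d' \in axdirs -> ksum Ye (padd c d') = 0 by move=> dd'; have [] := ksum_split (face_mid cF dd').
have Ye1 q : ~~ even2 q -> Ye q = 0 by rewrite /Ye => /negbTE->.
have m1 := mid (1, 0) isT; have m2 := mid (-1, 0) isT.
have m3 := mid (0, 1) isT; have m4 := mid (0, -1) isT.
rewrite cE /padd /= ?addr0 ?addrK in m1 m2 m3 m4.
rewrite (_ : 2 * x + 1 + 1 = 2 * (x + 1)) in m1; last by ring.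
rewrite (_ : 2 * y + 1 + 1 = 2 * (y + 1)) in m3; last by ring.
rewrite ksum_vmid in m1; rewrite ksum_vmid in m2; rewrite ksum_hmid in m3; rewrite ksum_hmid in m4.
rewrite !(Ye1 (_ + 1, _)) ?(Ye1 (_ - 1, _)) /even2 /= ?evenzE // in m1 m2 m3 m4.
rewrite cE /padd; move: dd; rewrite !inE => /or4P[] /eqP-> //=.
- rewrite ?addrK (_ : 2 * x + 1 + 1 = 2 * x + 2); last by ring.
  rewrite (_ : 2 * y + 1 + 1 = 2 * y + 2); last by ring.
  move: m2 m3; rewrite (_ : 2 * (y + 1) = 2 * y + 2); last by ring.
  lra.
- rewrite ?addrK (_ : 2 * x + 1 + 1 = 2 * (x + 1)); last by ring.
  rewrite (_ : 2 * y + 1 + 1 = 2 * y + 2); last by ring.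
  lra.
- rewrite ?addrK (_ : 2 * x + 1 + 1 = 2 * x + 2); last by ring.
  rewrite (_ : 2 * y + 1 + 1 = 2 * (y + 1)); last by ring.
  lra.
Qed.

(** The corner values are constant on each face, hence on all of H because touching faces share a
    corner, and they vanish at [w]. *)
Lemma right_kernel p : Y p = 0.
Proof.
have Ycorner a : a \in cornersH F -> Y a = 0.
  move=> aV; rewrite -Yw; move: aV wV; rewrite !cornersE.
  case/hasP=> d dd aF /hasP[d' dd' wF].
  have YF q e : e \in diagdirs -> padd q e \in F -> Y q = Y (padd (padd q e) (1, 1)).
    move=> ee qF; rewrite -(corner_const qF (opp_diagdirs ee)) padd_opp //.
  rewrite (YF a d) // (YF w d') //.
  apply: (connected_const (g := fun c => Y (padd c (1, 1))) hFt) => // c c' cF c'F /touch_corner.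
  by case=> e [e' [ee ee' eq_e]]; rewrite -(corner_const cF ee) -(corner_const c'F ee') eq_e.
have [N FN] := seq_bounded F.
(* The difference across the right side of a face is zero, so each face has the value of its right
   neighbour; the induction runs along the row until it has left [F]. *)
suff YF n (c : pt) : N - c.1 <= n%:Z -> Yf c = 0.
  rewrite YE (YF `|(N - p.1)%R|%N) ?addr0; last lia.
  rewrite /Ye; case: ifP => // p0; case pV : (p \in cornersH F); first exact: Ycorner.
  by apply: Y0; rewrite ?pV //; apply: contraL p0 => /(allP hFW1)/inW1_even2->.
elim: n c => [|n IHn] c Nc.
  by rewrite /Yf; case: ifP => // /FN; lia.
case cF : (c \in F); last by rewrite /Yf cF.
have [_] := ksum_split (face_mid cF (isT : (1, 0) \in axdirs)).
have [x [y cE]] := inW1_coord (allP hFW1 _ cF); have IHc := IHn (2 * x + 3, 2 * y + 1).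
have Yf1 q : ~~ inW1 q -> Yf q = 0.
  by rewrite /Yf; case: ifP => // /(allP hFW1)->.
rewrite cE /padd /= addr0 (_ : 2 * x + 1 + 1 = 2 * (x + 1)); last by ring.
rewrite ksum_vmid (_ : 2 * (x + 1) - 1 = 2 * x + 1); last by ring.
rewrite (_ : 2 * (x + 1) + 1 = 2 * x + 3); last by ring.
rewrite IHc; last by move: Nc; rewrite cE /=; lia.
by rewrite !(Yf1 (2 * _, _)) ?subr0 ?add0r // /inW1 /= evenzE.
Qed.
End RightKernel.

(** * Harmonic functions and Cramer's rule *)

(** Cramer's rule without division: the cofactors along column [j0] are those of [M]. *)
Lemma det_replace_col (R : comNzRingType) n (M : 'M[R]_n) (y : 'cV[R]_n) j0 :
  \det (\matrix_(i, j) if j == j0 then (M *m y) i ord0 else M i j) = y j0 ord0 * \det M.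
Proof.
rewrite (expand_det_col _ j0).
transitivity ((\adj M *m (M *m y)) j0 ord0); last first.
  by rewrite mulmxA mul_adj_mx mul_scalar_mx mxE mulrC.
rewrite [RHS]mxE; apply: eq_bigr => i _; rewrite !mxE eqxx mulrC; congr (_ * _).
rewrite /cofactor; congr (_ * \det _); apply/matrixP => k l; rewrite !mxE.
by rewrite eq_sym (negbTE (neq_lift _ _)).
Qed.

Lemma inj_unitmx (K : fieldType) n (M : 'M[K]_n) :
  (forall y : 'cV_n, M *m y = 0 -> y = 0) -> M \in unitmx.
Proof.
move=> inj; rewrite -unitmx_tr -row_free_unit; apply: inj_row_free => v vM.
apply: trmx_inj; rewrite trmx0; apply: inj.
by rewrite -[M]trmxK -trmx_mul vM trmx0.
Qed.

Lemma seq_argmin (z : pt -> rat) (F : seq pt) c : c \in F ->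
  exists2 m, m \in F & forall q, q \in F -> z m <= z q.
Proof.
elim: F c => // a F IHF c _; case: F IHF => [_|b F /(_ b)].
  by exists a => [|q]; rewrite mem_seq1 // => /eqP ->.
case=> [|m mF mmin]; first exact: mem_head.
have [zma|zam] := lerP (z m) (z a).
  exists m => [|q]; first by rewrite in_cons mF orbT.
  by rewrite in_cons => /predU1P[->|/mmin].
exists a => [|q]; first exact: mem_head.
by rewrite in_cons => /predU1P[->//|/mmin]; apply: le_trans (ltW zam).
Qed.

Definition laplace (z : pt -> rat) (c : pt) : rat :=
  4 * z c - \sum_(d <- axdirs2) z (padd c d).

(** Minimum principle: a negative minimum would spread to the right forever and leave the finite set
    [F], outside which [z] is zero. *)
Lemma laplace_ge0 (F : seq pt) (z : pt -> rat) :
  (forall p, p \notin F -> z p = 0) -> (forall c, c \in F -> 0 <= laplace z c) ->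
  forall p, 0 <= z p.
Proof.
move=> z0 zF p; case pF : (p \in F); last by rewrite z0 ?pF.
have [m mF mmin] := seq_argmin z pF.
suff : 0 <= z m by move=> /le_trans; apply; apply: mmin.
rewrite leNgt; apply/negP => zm0.
have zge q : z m <= z q by case qF : (q \in F); [apply: mmin | rewrite (z0 q) ?qF // ltW].
(* The four neighbours are at least [z m] and their mean is at most [z m], so each of them attains
   it. *)
have right c : c \in F -> z c = z m -> z (padd c (2, 0)) = z m.
  move=> /zF; rewrite /laplace /axdirs2 !big_cons big_nil => + zc; rewrite zc.
  have := zge (padd c (2, 0)); have := zge (padd c (-2, 0)).
  have := zge (padd c (0, 2)); have := zge (padd c (0, -2)); lra.
have [N FN] := seq_bounded F.
have far k : z (m.1 + 2 * k%:Z, m.2) = z m.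
  elim: k => [|k IHk]; first by rewrite mulr0 addr0; case: (m).
  have cF : (m.1 + 2 * k%:Z, m.2) \in F.
    by apply: contraTT zm0 => /z0; rewrite IHk => ->; rewrite ltxx.
  have := right _ cF IHk; rewrite /padd /= addr0 => <-; congr (z (_, _)); lia.
have /FN : (m.1 + 2 * (`|N| + `|m.1|)%:Z, m.2) \in F.
  apply: contraTT zm0 => /z0; rewrite -[_ + _ : nat]/(_ : nat) => zfar.
  by have := far (`|N| + `|m.1|)%N; rewrite zfar => <-; rewrite ltxx.
rewrite /=; lia.
Qed.

Lemma laplace_inj (F : seq pt) (z z' : pt -> rat) :
  (forall p, p \notin F -> z p = 0) -> (forall p, p \notin F -> z' p = 0) ->
  (forall c, c \in F -> laplace z c = laplace z' c) -> z =1 z'.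
Proof.
move=> z0 z0' zz' p.
have lapB f g c : laplace (fun q => f q - g q) c = laplace f c - laplace g c.
  by rewrite /laplace sumrB; ring.
have h1 : 0 <= z p - z' p.
  apply: (laplace_ge0 (F := F) (z := fun q => z q - z' q)) => [q qF|c cF].
    by rewrite z0 ?z0' ?subrr.
  by rewrite lapB zz' ?subrr.
have h2 : 0 <= z' p - z p.
  apply: (laplace_ge0 (F := F) (z := fun q => z' q - z q)) => [q qF|c cF].
    by rewrite z0 ?z0' ?subrr.
  by rewrite lapB zz' ?subrr.
lra.
Qed.

Lemma lamadj_dirs c q : inW1 c -> lamadj c q = (q \in [seq padd c d | d <- axdirs2]).
Proof.
move=> c1; rewrite /lamadj c1 andTb; apply/andP/mapP => [[q1 st]|[d dd ->]]; last first.
  rewrite axdirs2_inW1 //; split=> //; move: dd; case: c d {c1} => x y [z t].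
  by rewrite /psub /padd !inE /= => /or4P[] /eqP[-> ->]; rewrite !xpair_eqE; lia.
exists (psub q c); last by rewrite psub_dirs.
by move: st; case: c q {c1 q1} => x y [z t]; rewrite /psub !inE !xpair_eqE /=; lia.
Qed.

Section Faces.
Variables (F : seq pt) (fs : pt).
Hypothesis hFuniq : uniq F.
Hypothesis hFW1 : all inW1 F.
Hypothesis hfsW1 : inW1 fs.
Hypothesis hfsF : fs \notin F.

(** Extension by zero builds in the Dirichlet boundary condition, so that [Amx F] acts as
    [laplace]. *)
Definition face_ext (y : 'cV[rat]_(size F)) (p : pt) : rat :=
  if [pick i : 'I_(size F) | nth (0, 0) F i == p] is Some i then y i ord0 else 0.

Lemma face_ext_nth y (i : 'I_(size F)) : face_ext y (nth (0, 0) F i) = y i ord0.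
Proof.
rewrite /face_ext; case: pickP => [j|/(_ i)]; last by rewrite eqxx.
by rewrite nth_uniq // => /eqP/val_inj->.
Qed.

Lemma face_ext_out y p : p \notin F -> face_ext y p = 0.
Proof.
move=> pF; rewrite /face_ext; case: pickP => // i /eqP ip.
by move: pF; rewrite -ip mem_nth.
Qed.

Lemma sum_faces (h : pt -> rat) : \sum_(i < size F) h (nth (0, 0) F i) = \sum_(q <- F) h q.
Proof. by rewrite (big_nth (0, 0)) big_mkord. Qed.

Lemma sum_lamadj c (h : pt -> rat) : inW1 c -> (forall q, q \notin F -> h q = 0) ->
  \sum_(q <- F) (lamadj c q)%:R * h q = \sum_(d <- axdirs2) h (padd c d).
Proof.
move=> c1 h0; rewrite -(big_map (padd c) xpredT h).
have nu : uniq [seq padd c d | d <- axdirs2].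
  by rewrite map_inj_uniq // => d d' /(congr1 (psub^~ c)); rewrite !psub_padd.
rewrite [RHS](_ : _ = \sum_(q <- [seq padd c d | d <- axdirs2]) (lamadj c q)%:R * h q).
  apply: big_seq_support => // q; rewrite mulf_eq0 negb_or => /andP[cq hq].
  rewrite -lamadj_dirs //; move: cq; case: (lamadj c q) => //= _.
  by rewrite andbT; apply: contraNT hq => /h0->.
by apply: eq_big_seq => q; rewrite -lamadj_dirs // => ->; rewrite mul1r.
Qed.

Lemma Amx_laplace y (i : 'I_(size F)) :
  (Amx F *m y) i ord0 = laplace (face_ext y) (nth (0, 0) F i).
Proof.
set c := nth _ F i; have cF : c \in F by apply: mem_nth.
have c1 := allP hFW1 _ cF.
have irr : lamadj c c = false.
  by rewrite /lamadj /psub !subrr /= !andbF.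
rewrite /laplace -(sum_lamadj c1 (face_ext_out y)) -sum_faces mxE.
rewrite (bigD1 i) //= [in RHS](bigD1 i) //= -/c irr mul0r add0r mxE eqxx face_ext_nth -sumrN.
congr (_ + _); apply: eq_bigr => j ji; rewrite mxE eq_sym (negbTE ji) -/c face_ext_nth.
by case: ifP => _; rewrite ?mulN1r ?mul1r ?mul0r ?oppr0.
Qed.

Lemma Amx_unit : Amx F \in unitmx.
Proof.
apply: inj_unitmx => y Ay; apply/colP => i; rewrite -face_ext_nth mxE.
apply: (laplace_inj (F := F) (z' := fun=> 0)) => // [p|c /(nthP (0, 0))[k kF <-]].
  exact: face_ext_out.
rewrite -(Amx_laplace y (Ordinal kF)) Ay mxE /laplace mulr0 sub0r big1 ?oppr0 //.
Qed.

(** This is [pfun] without its boundary value 1 at [fs]; that value reappears as the source term in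
    [laplace_harm]. *)
Definition harm : pt -> rat := face_ext (pvec F fs).

Lemma harm_out p : p \notin F -> harm p = 0.
Proof. exact: face_ext_out. Qed.

Lemma pfun_face p : p \in F -> pfun F fs p = harm p.
Proof.
by rewrite /pfun; case: eqP => [->|//]; rewrite (negbTE hfsF).
Qed.

Lemma laplace_harm c : c \in F -> laplace harm c = (lamadj c fs)%:R.
Proof.
move=> /(nthP (0, 0))[k kF <-]; rewrite -(Amx_laplace _ (Ordinal kF)).
by rewrite /pvec mulmxA mulmxV ?Amx_unit // mul1mx mxE /=; case: ifP.
Qed.

Lemma harm_ge0 p : 0 <= harm p.
Proof.
by apply: (laplace_ge0 harm_out) => c /laplace_harm->; rewrite ler0n.
Qed.

End Faces.

Definition extend n (e : 'I_n -> pt) (y : 'I_n -> rat) (p : pt) : rat :=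
  \sum_i (e i == p)%:R * y i.

Lemma extend_out n (e : 'I_n -> pt) y p : (forall i, e i != p) -> extend e y p = 0.
Proof. by move=> off; apply: big1 => i _; rewrite (negbTE (off i)) mul0r. Qed.

Lemma extend_at n (e : 'I_n -> pt) y i : injective e -> extend e y (e i) = y i.
Proof.
move=> inj; rewrite /extend (bigD1 i) //= eqxx mul1r big1 ?addr0 // => j ji.
by rewrite (inj_eq inj) (negbTE ji) mul0r.
Qed.

Lemma ksum_indicator (q p : pt) : ksum (fun r => (q == r)%:R) p = kast p q.
Proof.
rewrite /ksum; case qp : (psub q p \in axdirs); last first.
  rewrite [RHS]/kast psubC_axdirs qp big_seq big1 // => d dd.
  case: (q =P padd p d) => [e|_]; last by rewrite mulr0.
  by rewrite e psub_padd dd in qp.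
rewrite (bigD1_seq (psub q p)) //= psub_dirs eqxx mulr1 big1 ?addr0 // => d dq.
case: (q =P padd p d) => [e|_]; last by rewrite mulr0.
by move: dq; rewrite e psub_padd eqxx.
Qed.

Lemma ksum_extend n (e : 'I_n -> pt) y p :
  ksum (extend e y) p = \sum_i kast p (e i) * y i.
Proof.
rewrite /ksum /extend; under eq_bigr do rewrite mulr_sumr.
rewrite exchange_big /=; apply: eq_bigr => i _.
rewrite -ksum_indicator /ksum mulr_suml; apply: eq_bigr => d _.
by rewrite mulrA.
Qed.

Lemma map_nth_ord (T : Type) (x0 : T) (s : seq T) n : size s = n ->
  [seq nth x0 s i | i : 'I_n] = s.
Proof.
move=> <-; rewrite /image_mem -[RHS](mkseq_nth x0) /mkseq -val_enum_ord -map_comp.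
by rewrite enumT; congr map; rewrite -enumT.
Qed.

Definition swap (T : Type) n (f : 'I_n -> T) (j0 : 'I_n) (a : T) (j : 'I_n) : T :=
  if j == j0 then a else f j.

Lemma perm_swap (T : eqType) n (f : 'I_n -> T) j0 a b (s t : seq T) :
  perm_eq s (t ++ [seq f i | i : 'I_n] ++ [:: a; b]) ->
  perm_eq s (t ++ [seq swap f j0 a i | i : 'I_n] ++ [:: f j0; b]).
Proof.
move/perm_trans; apply; rewrite perm_cat2l.
have en := perm_to_rem (mem_enum 'I_n j0); set r := rem j0 _ in en.
have rE : [seq swap f j0 a i | i <- r] = [seq f i | i <- r].
  apply/eq_in_map => i; rewrite mem_rem_uniq ?enum_uniq // inE => /andP[ij _].
  by rewrite /swap (negbTE ij).
apply: (perm_trans (perm_cat (perm_map f en) (perm_refl _))).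
rewrite perm_sym; apply: (perm_trans (perm_cat (perm_map _ en) (perm_refl _))).
rewrite /= rE /swap eqxx; apply/seq.permP => p; rewrite /= !count_cat /=.
move: (count p _) (nat_of_bool (p a)) (nat_of_bool (p (f j0))) => *; lia.
Qed.

(** * Kasteleyn determinants with two white columns deleted *)

Section Determinants.
Variables (F : seq pt) (fs : pt).
Hypothesis hFuniq : uniq F.
Hypothesis hFW1 : all inW1 F.
Hypothesis hFsc : faces_simply_connected F.
Hypothesis hfsW1 : inW1 fs.
Hypothesis hfsF : fs \notin F.
Local Notation V := (VG F fs).
Local Notation T := (seq_sub V).

Let V_uniq : uniq V := undup_uniq _.

Variable fsT : T.
Hypothesis fsTE : val fsT = fs.

Let mid_val (u : T) : ~~ white (val u) -> val u \in midsH F.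
Proof. by move=> ub; rewrite -(VG_black hFW1 hfsW1 ub); exact: valP. Qed.

Let val_cases (u : T) : [\/ val u \in midsH F, val u \in cornersH F, val u \in F | u = fsT].
Proof.
have := valP u; rewrite memVG => /or4P[h|/eqP h|h|h].
- exact: Or42.
- by apply: Or44; apply: val_inj; rewrite fsTE.
- exact: Or43.
- exact: Or41.
Qed.

Let corner_white p : p \in cornersH F -> white p.
Proof. by move/(corner_even2 hFW1) => p0; rewrite white_even2 p0. Qed.

Let face_white p : p \in F -> white p.
Proof. by move/(allP hFW1) => p0; rewrite white_even2 p0 orbT. Qed.

Definition kmx n (bn wn : 'I_n -> T) : 'M[rat]_n := \matrix_(i, j) kast (val (bn i)) (val (wn j)).

(** Lists the vertices other than the deleted white pair [a], [b]. Arbitrary orders are allowed so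
    that changing the deleted pair replaces a single column; an absolute determinant does not depend
    on the order. *)
Record enumeration n (bn wn : 'I_n -> T) (a b : T) : Prop := Enumeration {
  enum_perm : perm_eq (enum {: T}) ([seq bn i | i : 'I_n] ++ [seq wn i | i : 'I_n] ++ [:: a; b]);
  enum_black : forall i, ~~ white (val (bn i));
  enum_white : forall i, white (val (wn i)) }.

Lemma enumeration_swap n (bn wn : 'I_n -> T) a b j0 : white (val a) ->
  enumeration bn wn a b -> enumeration bn (swap wn j0 a) (wn j0) b.
Proof.
move=> aw [ep eb ew]; split=> [|//|i]; first exact: perm_swap.
by rewrite /swap; case: ifP.
Qed.

Lemma enumerationC n (bn wn : 'I_n -> T) a b : enumeration bn wn a b -> enumeration bn wn b a.
Proof.
case=> ep eb ew; split=> //; apply: perm_trans ep _; rewrite !perm_cat2l.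
by apply/seq.permP => p /=; rewrite addnCA.
Qed.

Lemma det_swap n (bn wn : 'I_n -> T) j0 a (y : 'cV_n) :
  (forall i, (kmx bn wn *m y) i ord0 = kast (val (bn i)) (val a)) ->
  \det (kmx bn (swap wn j0 a)) = y j0 ord0 * \det (kmx bn wn).
Proof.
move=> My; rewrite -det_replace_col; congr (\det _); apply/matrixP => i j; rewrite !mxE /swap.
by case: ifP => _; rewrite -?My ?mxE.
Qed.

Lemma enumeration_case n (bn wn : 'I_n -> T) a b u : enumeration bn wn a b ->
  white (val u) -> u != a -> u != b -> exists j, wn j = u.
Proof.
case=> ep eb ew uw ua ub; have [[i e]|[i e]|e|e] := T_case ep u.
- by move: uw; rewrite e (negbTE (eb i)).
- by exists i.
- by rewrite e eqxx in ua.
- by rewrite e eqxx in ub.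
Qed.

(** The matrix starts out rectangular, indexed by all black vertices and all white ones except [fs]
    and [w]. Trivial kernels on both sides force full row and column rank, hence equal sizes and a
    nonzero determinant. *)
Lemma base_enumeration (w : T) : val w \in cornersH F ->
  exists n (bn wn : 'I_n -> T), enumeration bn wn fsT w /\ \det (kmx bn wn) != 0.
Proof.
move=> wc.
pose sB := [seq u <- enum {: T} | ~~ white (val u)].
pose sJ := [seq u <- enum {: T} | [&& white (val u), u != fsT & u != w]].
have fsw : fsT != w.
  apply/eqP => e; have := corner_even2 hFW1 wc; rewrite -e fsTE.
  by move/(@inW1_even2 fs): hfsW1 => ->.
have sBu : uniq sB by rewrite filter_uniq ?enum_uniq.
have sJu : uniq sJ by rewrite filter_uniq ?enum_uniq.
pose b i : T := nth fsT sB i; pose j i : T := nth fsT sJ i.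
have bin (i : 'I_(size sB)) : b i \in sB by rewrite mem_nth.
have jin (i : 'I_(size sJ)) : j i \in sJ by rewrite mem_nth.
pose K : 'M[rat]_(size sB, size sJ) := \matrix_(i, k) kast (val (b i)) (val (j k)).
have b_black (i : 'I_(size sB)) : ~~ white (val (b i)).
  by have := bin i; rewrite mem_filter => /andP[].
have jP (k : 'I_(size sJ)) : [&& white (val (j k)), j k != fsT & j k != w].
  by have := jin k; rewrite mem_filter => /andP[].
have b_inj : injective (fun i : 'I_(size sB) => val (b i)).
  by move=> i i' /val_inj/eqP; rewrite nth_uniq // => /eqP/val_inj.
have j_inj : injective (fun i : 'I_(size sJ) => val (j i)).
  by move=> i i' /val_inj/eqP; rewrite nth_uniq // => /eqP/val_inj.
have bE p : p \in midsH F -> exists i : 'I_(size sB), val (b i) = p.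
  move=> pm; have pV : p \in V by rewrite memVG pm !orbT.
  have : SeqSub pV \in sB by rewrite mem_filter mem_enum andbT (mid_black hFW1).
  by case/(nthP fsT) => i ilt ei; exists (Ordinal ilt); rewrite /b ei.
have jE p (pV : p \in V) : white p -> p != fs -> p != val w ->
    exists k : 'I_(size sJ), val (j k) = p.
  move=> pw pfs pnw; have : SeqSub pV \in sJ.
    rewrite mem_filter mem_enum andbT pw -(inj_eq val_inj) fsTE pfs.
    by rewrite -(inj_eq val_inj).
  by case/(nthP fsT) => i ilt ei; exists (Ordinal ilt); rewrite /j ei.
have left (x : 'rV_(size sB)) : x *m K = 0 -> x = 0.
  move=> xK; pose X := extend (fun i : 'I_(size sB) => val (b i)) (fun i => x ord0 i).
  have XK (k : 'I_(size sJ)) : ksum X (val (j k)) = (x *m K) ord0 k.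
    by rewrite ksum_extend mxE; apply: eq_bigr => i _; rewrite !mxE kastC mulrC.
  have X0 : forall p, X p = 0.
    apply: (left_kernel hFW1 hfsW1 hfsF hFsc.2 wc) => [p pm|a ac aw|c cF].
    - by apply: extend_out => i; apply: contraNneq pm => <-; apply: mid_val.
    - have aV : a \in V by rewrite memVG ac.
      have afs : a != fs.
        by apply: contraTneq (corner_even2 hFW1 ac) => ->; rewrite inW1_even2.
      by have [k <-] := jE a aV (corner_white ac) afs aw; rewrite XK xK mxE.
    - have cV : c \in V by rewrite memVG cF !orbT.
      have cfs : c != fs by apply: contraNneq hfsF => <-.
      have cw : c != val w.
        apply: contraTneq (allP hFW1 _ cF) => ->; apply/negP => /inW1_even2.
        by rewrite (corner_even2 hFW1 wc).
      by have [k <-] := jE c cV (face_white cF) cfs cw; rewrite XK xK mxE.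
  by apply/rowP => i; rewrite mxE -[LHS](extend_at (fun i => x ord0 i) i b_inj); apply: X0.
have right (y : 'cV_(size sJ)) : K *m y = 0 -> y = 0.
  move=> Ky; pose Y := extend (fun i : 'I_(size sJ) => val (j i)) (fun i => y i ord0).
  have YK (i : 'I_(size sB)) : ksum Y (val (b i)) = (K *m y) i ord0.
    by rewrite ksum_extend mxE; apply: eq_bigr => k _; rewrite !mxE.
  have Y0 : forall p, Y p = 0.
    apply: (right_kernel fs hFW1 hFsc.1 wc) => [p pc pF||p pm].
    - apply: extend_out => k; have /and3P[jw jfs _] := jP k.
      apply/eqP => e; case: (val_cases (j k)) => h.
      + by move: (mid_black hFW1 h); rewrite jw.
      + by rewrite e (negbTE pc) in h.
      + by rewrite e (negbTE pF) in h.
      + by rewrite h eqxx in jfs.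
    - by apply: extend_out => k; have /and3P[_ _] := jP k; rewrite (inj_eq val_inj).
    - by have [i <-] := bE p pm; rewrite YK Ky mxE.
  by apply/colP => i; rewrite mxE -[LHS](extend_at (fun i => y i ord0) i j_inj); apply: Y0.
have rK : row_free K by apply: inj_row_free.
have rKT : row_free K^T.
  apply: inj_row_free => v vK; apply: trmx_inj; rewrite trmx0; apply: right.
  by rewrite -[K]trmxK -trmx_mul vK trmx0.
have sizeE : size sJ = size sB.
  by move: rK rKT; rewrite /row_free mxrank_tr => /eqP rB /eqP rJ; apply: etrans (esym rJ) rB.
exists (size sB), (fun i => b i), (fun i => j i); split; last first.
  rewrite -unitfE -unitmxE; apply: inj_unitmx => y My.
  pose y' : 'cV_(size sJ) := \col_k y (cast_ord sizeE k) ord0.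
  have : y' = 0.
    apply: right; apply/colP => i; rewrite mxE [RHS]mxE.
    have /colP/(_ i) := My; rewrite mxE [RHS]mxE => My0; rewrite -[RHS]My0.
    rewrite [RHS](reindex (cast_ord sizeE)) /=; last first.
      by exists (cast_ord (esym sizeE)) => k _; rewrite ?cast_ordK ?cast_ordKV.
    by apply: eq_bigr => k _; rewrite !mxE.
  move/colP => y0; apply/colP => k; have := y0 (cast_ord (esym sizeE) k).
  by rewrite !mxE cast_ordKV.
split=> [|i|i]; first 1 last.
- exact: b_black.
- have ilt : (i < size sJ)%N by rewrite sizeE.
  by have /and3P[] := jP (Ordinal ilt).
rewrite !map_nth_ord //; apply: (perm_trans (y := sB ++ [seq u <- enum {: T} | white (val u)])).
  rewrite perm_sym perm_catC -(permPr (permEl (perm_filterC (fun u : T => white (val u)) _))).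
  exact: perm_refl.
rewrite perm_cat2l; apply: uniq_perm.
- by rewrite filter_uniq ?enum_uniq.
- rewrite cat_uniq sJu /= !mem_filter !eqxx !andbF /= inE fsw.
  by rewrite andbT.
move=> u; rewrite mem_cat mem_filter mem_enum mem_filter mem_enum !inE !andbT.
have [->|ufs] := eqVneq u fsT; first by rewrite fsTE white_even2 hfsW1 !orbT.
have [->|uw] := eqVneq u w; first by rewrite corner_white ?orbT.
by rewrite !andbT !orbF.
Qed.
Lemma enumeration_mid n (bn wn : 'I_n -> T) w b :
  enumeration bn wn fsT w -> val w \in cornersH F -> b \in midsH F -> exists i, val (bn i) = b.
Proof.
case=> ep eb ew wc bm; have bV : b \in V by rewrite memVG bm !orbT.
have bb := mid_black hFW1 bm.
case: (T_case ep (SeqSub bV)) => [[i e]|[i e]|e|e].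
- by exists i; rewrite -e.
- by have := ew i; rewrite -e (negbTE bb).
- by move: bb; rewrite -[b]/(val (SeqSub bV)) e fsTE white_even2 hfsW1 orbT.
- by move: bb; rewrite -[b]/(val (SeqSub bV)) e corner_white.
Qed.

(* The columns of the corners sum to zero. *)
Lemma det_corner_swap n (bn wn : 'I_n -> T) w0 j0 :
  enumeration bn wn fsT w0 -> val w0 \in cornersH F -> val (wn j0) \in cornersH F ->
  \det (kmx bn (swap wn j0 w0)) = - \det (kmx bn wn).
Proof.
move=> en w0c j0c; have [ep eb ew] := en.
pose y : 'cV[rat]_n := \col_j - (val (wn j) \in cornersH F)%:R.
rewrite (@det_swap n bn wn j0 w0 y) => [|i]; first by rewrite mxE j0c mulN1r.
have bm := mid_val (eb i).
have c0 q : q \notin V -> (q \in cornersH F)%:R = 0 :> rat.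
  by rewrite memVG negb_or => /andP[/negbTE->].
have := ksum_corners hFW1 bm; rewrite -(sum_kast _ V_uniq c0) -sum_seq_sub //.
rewrite -big_enum (perm_big _ ep) !big_cat /= !big_image /= !big_cons big_nil w0c fsTE.
have -> : (fs \in cornersH F) = false.
  by apply: contraTF hfsW1 => /(corner_even2 hFW1); apply: contraTN => /inW1_even2 ->.
rewrite big1 => [|k _]; last first.
  by case: (val (bn k) \in _) / boolP => [/corner_white|_]; rewrite ?(negbTE (eb k)) ?mulr0.
rewrite add0r mulr0 add0r addr0 mulr1 => /eqP; rewrite addrC addr_eq0 => /eqP ->.
by rewrite mxE -sumrN; apply: eq_bigr => k _; rewrite !mxE mulrN.
Qed.

(** Putting [w0] back in the column of [w] costs only a sign. *)
Lemma corner_dets (w0 : T) : val w0 \in cornersH F -> exists2 D : rat, 0 < D &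
  forall w : T, val w \in cornersH F -> exists n (bn wn : 'I_n -> T),
    enumeration bn wn fsT w /\ `|\det (kmx bn wn)| = D.
Proof.
move=> w0c; have [n [bn [wn [en det0]]]] := base_enumeration w0c.
exists `|\det (kmx bn wn)|; first by rewrite normr_gt0.
move=> w wc; have [->|ww0] := eqVneq w w0; first by exists n, bn, wn.
have wfs : w != fsT.
  apply/eqP => e; have := corner_even2 hFW1 wc; rewrite e fsTE.
  by move/(@inW1_even2 fs): hfsW1 => ->.
have [j0 ej0] := enumeration_case en (corner_white wc) wfs ww0.
exists n, bn, (swap wn j0 w0); split; last first.
  by rewrite (det_corner_swap en) ?ej0 // normrN.
rewrite -ej0; apply/enumerationC/enumeration_swap; first exact: corner_white.
exact: enumerationC.
Qed.

Lemma sum_indicator (s : seq pt) (x : pt) : uniq s ->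
  \sum_(q <- s) (x == q)%:R = (x \in s)%:R :> rat.
Proof.
move=> us; case xs : (x \in s).
  by rewrite (bigD1_seq x) //= eqxx big1 ?addr0 // => q /negbTE; rewrite eq_sym => ->.
by rewrite big_seq big1 // => q qs; case: eqP => // e; rewrite e qs in xs.
Qed.

(* Cramer's rule: the column of fs is a combination of the others whose coefficients on the faces
   solve the discrete Dirichlet problem, up to sign. *)
Lemma det_face_swap n (bn wn : 'I_n -> T) (w v : T) :
  enumeration bn wn fsT w -> val w \in cornersH F -> \det (kmx bn wn) != 0 -> val v \in F ->
  exists2 wn', enumeration bn wn' v w & `|\det (kmx bn wn')| = harm F fs (val v) * `|\det (kmx bn wn)|.
Proof.
move=> en wc det0 vF; have [ep eb ew] := en.
have fs_white : white fs by rewrite white_even2 hfsW1 orbT.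
have vfs : v != fsT by apply: contraNneq hfsF => e; rewrite -fsTE -e.
have vw : v != w.
  by apply: contraTneq (allP hFW1 _ vF) => ->; apply/negP => /inW1_even2; rewrite (corner_even2 hFW1).
have [j0 ej0] := enumeration_case en (face_white vF) vfs vw.
have M1 : kmx bn wn \in unitmx by rewrite unitmxE unitfE.
have [y My] : exists y : 'cV_n, forall i, (kmx bn wn *m y) i ord0 = kast (val (bn i)) (val fsT).
  exists (invmx (kmx bn wn) *m \col_i kast (val (bn i)) (val fsT)) => i.
  by rewrite mulmxA mulmxV // mul1mx mxE.
exists (swap wn j0 fsT); first by rewrite -ej0; apply: enumeration_swap; rewrite ?fsTE.
rewrite (@det_swap n bn wn j0 fsT y My) normrM; congr (_ * _).
have wn_inj : injective (fun i => val (wn i)).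
  by move=> i i' /val_inj; have [_ inj _ _] := T_matching ep; apply: inj.
have wn_fs i : wn i != fsT by have [_ _ h _] := T_matching ep; apply: h.
pose Y := extend (fun i => val (wn i)) (fun i => y i ord0).
have -> : y j0 ord0 = Y (val v).
  by rewrite -ej0 -[LHS](extend_at (fun i => y i ord0) j0 wn_inj).
have YK b : b \in midsH F -> ksum Y b = kast b fs.
  move=> bm; have [i <-] := enumeration_mid en wc bm.
  have Myi := My i; rewrite fsTE in Myi.
  by rewrite -Myi ksum_extend mxE; apply: eq_bigr => k _; rewrite !mxE.
have Yout q : inW1 q -> q \notin F -> Y q = 0.
  move=> q1 qF; apply: extend_out => i; apply/eqP => e.
  have : q \in V by rewrite -e; apply: valP.
  rewrite (VG_inW1 fs hFW1) // (negbTE qF) orbF => /eqP qfs.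
  by have := wn_fs i; rewrite -(inj_eq val_inj) fsTE e qfs eqxx.
pose z q := if q \in F then - Y q else 0.
have zE : z =1 harm F fs.
  apply: (laplace_inj (F := F)) => [q /negbTE|q|c cF]; first by rewrite /z => ->.
    exact: harm_out.
  have c1 := allP hFW1 _ cF.
  rewrite (laplace_harm fs hFuniq hFW1) // lamadj_dirs // -sum_indicator; last first.
    by rewrite map_inj_uniq // => d d' /(congr1 (psub^~ c)); rewrite !psub_padd.
  rewrite big_map /laplace {1}/z cF.
  rewrite (eq_big_seq (fun d => - Y (padd c d))) => [|d dd]; last first.
    rewrite /z; case: ifPn => // /Yout; rewrite axdirs2_inW1 // => /(_ c1) ->.
    by rewrite oppr0.
  (* At the four midpoints around [c], [ksum Y] agrees with [ksum] of the indicator of [fs]; a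
     second application at [c] equates the two Laplacians. *)
  have := ksum_ksum Y c; have := ksum_ksum (fun r => (fs == r)%:R) c.
  have -> : ksum (ksum (fun r => (fs == r)%:R)) c = ksum (ksum Y) c.
    by apply: eq_big_seq => d dd; rewrite ksum_indicator (YK _ (face_mid cF dd)).
  have -> : (fs == c) = false by apply: contraNF hfsF => /eqP->.
  rewrite sumrN mulr0; move: (ksum _ _) (\sum_(d <- _) _) (\sum_(d <- _) _) (Y c) => *; lra.
have zv : harm F fs (val v) = - Y (val v) by rewrite -zE /z vF.
by rewrite zv -normrN ger0_norm // -zv harm_ge0.
Qed.

End Determinants.

(** * Corners of the outer face *)

Definition double_pt (d : pt) : pt := (d.1 + d.1, d.2 + d.2).

Lemma double_axdirs d : d \in axdirs -> double_pt d \in axdirs2.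
Proof. by case: d => x y; rewrite !inE => /or4P[] /eqP[-> ->]. Qed.

Lemma lamadjC p q : lamadj p q = lamadj q p.
Proof.
rewrite /lamadj andbCA; congr [&& _, _ & _]; case: p q => x y [x' y'].
by rewrite /psub !inE !xpair_eqE /=; lia.
Qed.

Section Corners.
Variables (F : seq pt) (fs : pt).
Hypothesis hFuniq : uniq F.
Hypothesis hFW1 : all inW1 F.
Hypothesis hFsc : faces_simply_connected F.
Hypothesis hfsW1 : inW1 fs.
Hypothesis hfsF : fs \notin F.
Hypothesis hperp : lamperp_simply_connected (fs :: F).

(** Coordinates on the dual lattice with [fs] as origin and side 2 rescaled to 1; the division is
    exact on W1. *)
Definition rel_pt (c : pt) : pt := (((c.1 - fs.1) %/ 2)%Z, ((c.2 - fs.2) %/ 2)%Z).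

Lemma rel_ptE c : inW1 c -> c = padd fs (double_pt (rel_pt c)).
Proof.
rewrite /rel_pt; case: c fs hfsW1 => x y [x0 y0].
by rewrite /inW1 /evenz /padd /double_pt /= => h h'; congr pair; lia.
Qed.

Lemma rel_pt_double d : rel_pt (padd fs (double_pt d)) = d.
Proof.
by case: d => x y; rewrite /rel_pt /padd /double_pt /=; congr pair; lia.
Qed.

Lemma rel_pt_inj c c' : inW1 c -> inW1 c' -> rel_pt c = rel_pt c' -> c = c'.
Proof. by move=> c1 c1' e; rewrite (rel_ptE c1) e -rel_ptE. Qed.

Lemma rel_lamadj c c' : lamadj c c' -> psub (rel_pt c') (rel_pt c) \in axdirs.
Proof.
case/and3P => /rel_ptE cE /rel_ptE cE'; rewrite {1}cE {1}cE'.
case: (rel_pt c) (rel_pt c') => x y [x' y'].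
rewrite /psub /padd /double_pt !inE !xpair_eqE /=; lia.
Qed.

Lemma rel_touchadj c c' : inW1 c -> inW1 c' -> touchadj c c' ->
  psub (rel_pt c) (rel_pt c') \in axdirs ++ diagdirs.
Proof.
move=> /rel_ptE cE /rel_ptE cE'; rewrite {1}cE {1}cE' mem_cat /touchadj.
case: (rel_pt c) (rel_pt c') => x y [x' y'] /=.
rewrite /psub /padd /double_pt !inE !xpair_eqE /=; lia.
Qed.

(* A walk fs, Q, ..., P, fs avoiding F has a constant winding number around the connected set F,
   while this number jumps across the edges from fs to P and to Q only. *)
Lemma corner_winding (P Q : pt) : P \in axdirs -> Q \in axdirs ->
  padd fs (double_pt P) \notin F -> padd fs (double_pt Q) \notin F ->
  exists (s : int -> int -> int) (k : int),
    (forall d, d \in diagdirs -> padd fs d \in cornersH F ->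
       s ((d.1 - 1) %/ 2)%Z ((d.2 - 1) %/ 2)%Z = k) /\
    [/\ s (-1) 0 - s 0 0 = (Q == (0, 1))%:R - (P == (0, 1))%:R,
        s (-1) (-1) - s 0 (-1) = (P == (0, -1))%:R - (Q == (0, -1))%:R,
        s 0 0 - s 0 (-1) = (Q == (1, 0))%:R - (P == (1, 0))%:R
      & s (-1) 0 - s (-1) (-1) = (P == (-1, 0))%:R - (Q == (-1, 0))%:R].
Proof.
move=> Pax Qax PF QF.
pose X := [pred x | inW1 x && (x \notin fs :: F)].
have inX d : d \in axdirs -> padd fs (double_pt d) \notin F -> X (padd fs (double_pt d)).
  move=> dd dF; rewrite /X /= axdirs2_inW1 ?double_axdirs // hfsW1 in_cons negb_or dF andbT.
  apply/eqP => e; have := rel_pt_double d; rewrite e -[fs]/fs /rel_pt !subrr div0z => ed.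
  by rewrite -ed in dd.
set P' := padd fs (double_pt P); set Q' := padd fs (double_pt Q).
have [l [lpath llast lall]] := hperp.2 Q' P' (inX Q Qax QF) (inX P Pax PF).
have Lall : all X (Q' :: l) by apply/andP; split; [apply: (inX Q Qax QF) | apply: lall].
(* Index [n] is one past the end of the list, and the default [fs] read there closes the walk. *)
pose a i := rel_pt (nth fs (fs :: Q' :: l) i); pose n := (size l).+2.
have a_n : a n = a 0%N by rewrite /a nth_default.
have lam_fs d : d \in axdirs -> lamadj fs (padd fs (double_pt d)).
  move=> dd; rewrite lamadjC /lamadj hfsW1 axdirs2_inW1 ?double_axdirs // hfsW1 psub_padd.
  exact: double_axdirs.
have a_step i : (i < n)%N -> psub (a i.+1) (a i) \in axdirs.
  move=> ilt; apply: rel_lamadj.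
  have : path lamadj fs (rcons (Q' :: l) fs).
    by rewrite rcons_path /= lpath llast [lamadj P' _]lamadjC /P' /Q' !lam_fs.
  move/(pathP fs)/(_ i); rewrite size_rcons => /(_ ilt).
  by rewrite nth_rcons_default -rcons_cons nth_rcons_default.
have [M [s [aM sU sR s0]]] := walk_potential a_n a_step.
have aX i : (0 < i < n)%N -> X (nth fs (fs :: Q' :: l) i).
  by case: i => // i ilt; apply: (allP Lall (nth fs (Q' :: l) i)); apply: mem_nth.
have a_fs i : (0 < i < n)%N -> a i != (0, 0).
  move=> ilt; have /andP[i1] := aX i ilt; rewrite in_cons negb_or => /andP[ifs _].
  apply: contra ifs => /eqP e; apply/eqP/rel_pt_inj => //.
  by rewrite -/(a i) e /rel_pt !subrr.
have a0 : a 0%N = (0, 0) by rewrite /a /rel_pt !subrr.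
(* The origin is visited only at times 0 and n, so flow leaves it towards [Q] and enters it from [P]
   only. *)
have net0 q : net a n (0, 0) q = (Q == q)%:R - (P == q)%:R.
  rewrite /net sumrB; congr (_ - _).
    rewrite big_ord_recl /= a0 eqxx /= {1}/a /= rel_pt_double big1 ?addr0 // => i _.
    by rewrite (negbTE (a_fs _ _)) // /bump /= ltnS ltn_ord.
  rewrite big_ord_recr /= -/n a_n a0 eqxx andbT big1 ?add0r => [|i _].
    by rewrite /a /= nth_last [last _ _]llast rel_pt_double.
  by rewrite (negbTE (a_fs i.+1 _)) ?andbF //= ltnS ltn_ord.
have offF c i : c \in F -> (i <= n)%N -> a i != rel_pt c.
  move=> cF ilen; have c1 := allP hFW1 _ cF; apply/eqP => e.
  have [i1 iF] : inW1 (nth fs (fs :: Q' :: l) i) /\ nth fs (fs :: Q' :: l) i \notin F.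
    have [i0|] := boolP (0 < i < n)%N.
      by have /andP[-> ] := aX i i0; rewrite in_cons negb_or => /andP[].
    case: i ilen {e} => [|i] //= ilen; rewrite -leqNgt => nlt.
    by rewrite nth_default.
  by move: iF; rewrite (rel_pt_inj i1 c1 e) cF.
pose f c := s (rel_pt c).1 ((rel_pt c).2 - 1).
have fconst c c' : c \in F -> c' \in F -> f c = f c'.
  apply: (connected_const (g := f) hFsc.1) => x y xF yF xy.
  apply: (potential_off sU sR) => [i|i|]; [exact: offF | exact: offF |].
  by apply: rel_touchadj; rewrite ?(allP hFW1).
exists s, (f (head fs F)); split; last first.
  have := sU 0 0; have := sU 0 (-1); have := sR 0 0; have := sR (-1) 0.
  rewrite !sub0r !add0r addNr (netC _ _ (-1, 0)) (netC _ _ (0, -1)) !net0.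
  by move=> -> -> -> ->; rewrite !opprB.
move=> d dd; rewrite cornersE => /hasP[d' dd' cF].
set c := padd (padd fs d) d' in cF.
have headF : head fs F \in F by case: (F) cF => //= x r _; rewrite mem_head.
rewrite -(fconst c) // /f.
rewrite -(walk_off (d'.1 == 1) (d'.2 == 1) sU sR (fun i => offF c i cF)).
have -> : rel_pt c = (((d.1 + d'.1) %/ 2)%Z, ((d.2 + d'.2) %/ 2)%Z).
  by rewrite /c /rel_pt /padd /=; congr pair; congr (_ %/ 2)%Z; ring.
move: dd dd'; case: d d' {c cF} => x y [x' y'].
by rewrite !inE => /or4P[] /eqP[-> ->] /or4P[] /eqP[-> ->].
Qed.

Lemma dstarE : (dstar F fs)%:R = \sum_(d <- axdirs) (padd fs (double_pt d) \in F)%:R :> rat.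
Proof.
transitivity (\sum_(d <- axdirs2) (padd fs d \in F)%:R : rat); last first.
  by rewrite /axdirs2 /axdirs !big_cons !big_nil.
have -> := esym (@sum_lamadj F hFuniq fs (fun q => (q \in F)%:R) hfsW1 _); last first.
  by move=> q /negbTE->.
rewrite /dstar -sum1_count natr_sum big_mkcond big_seq [RHS]big_seq; apply: eq_bigr => q qF.
by rewrite qF lamadjC; case: lamadj; rewrite ?mulr1 ?mul0r.
Qed.

Lemma corner_of_face e d : e \in axdirs -> d \in diagdirs -> psub (double_pt e) d \in diagdirs ->
  padd fs (double_pt e) \in F -> padd fs d \in cornersH F.
Proof.
move=> _ dd dd' eF; rewrite cornersE; apply/hasP; exists (psub (double_pt e) d) => //.
by move: eF; congr (_ \in F); rewrite /padd /psub /=; congr pair; ring.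
Qed.

(** The faces adjacent to [fs] form one contiguous arc: its [dstar] consecutive sides have one more
    end point than sides, and no further corner of [fs] belongs to H. Between one and three sides
    are adjacent to faces. *)
Lemma corner_count c0 : c0 \in F ->
  \sum_(d <- diagdirs) (padd fs d \in cornersH F)%:R = (dstar F fs)%:R + 1 :> rat.
Proof.
move=> c0F; rewrite dstarE /diagdirs /axdirs !big_cons !big_nil.
have some_face : exists2 d, d \in axdirs & padd fs (double_pt d) \in F.
  have [[|r l] [lpath llast lall]] := hperp.1 fs c0 (mem_head _ _) (mem_behead (s := fs :: F) c0F).
    by move: hfsF; rewrite -[fs]/(last fs [::]) llast c0F.
  move: lpath lall => /= /andP[fr _] /andP[rF _].
  have r1 : inW1 r by case/and3P: fr.
  exists (psub (rel_pt r) (rel_pt fs)); first exact: rel_lamadj.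
  have -> : psub (rel_pt r) (rel_pt fs) = rel_pt r.
    by rewrite /psub /rel_pt !subrr !div0z !subr0.
  move: rF; rewrite -rel_ptE // => /predU1P[rfs|//].
  by move: (rel_lamadj fr); rewrite rfs /psub !subrr.
have some_out : exists2 d, d \in axdirs & padd fs (double_pt d) \notin F.
  have [N FN] := seq_bounded F.
  pose q := padd fs (double_pt (`|N| + `|fs.1| + 1, 0)).
  have qF : q \notin F by apply/negP => /FN; rewrite /q /padd /double_pt /=; lia.
  have q1 : inW1 q by move: hfsW1; rewrite /q /inW1 /evenz /padd /double_pt /=; lia.
  have [[|r l] [lpath llast lall]] := hFsc.2 fs q (introT andP (conj hfsW1 hfsF)) (introT andP (conj q1 qF)).
    have : rel_pt fs = rel_pt q by rewrite -llast.
    rewrite rel_pt_double /rel_pt !subrr; clear; case; lia.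
  move: lpath lall => /= /andP[fr _] /andP[/andP[r1 rF] _].
  exists (psub (rel_pt r) (rel_pt fs)); first exact: rel_lamadj.
  have -> : psub (rel_pt r) (rel_pt fs) = rel_pt r.
    by rewrite /psub /rel_pt !subrr !div0z !subr0.
  by rewrite -rel_ptE.
have side P Q := @corner_winding P Q.
have face_corner e d := @corner_of_face e d.
pose E d := padd fs (double_pt d) \in F; pose K d := padd fs d \in cornersH F.
have i1 := face_corner (1, 0) (1, 1) isT isT isT; have i2 := face_corner (1, 0) (1, -1) isT isT isT.
have i3 := face_corner (-1, 0) (-1, 1) isT isT isT; have i4 := face_corner (-1, 0) (-1, -1) isT isT isT.
have i5 := face_corner (0, 1) (1, 1) isT isT isT; have i6 := face_corner (0, 1) (-1, 1) isT isT isT.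
have i7 := face_corner (0, -1) (1, -1) isT isT isT; have i8 := face_corner (0, -1) (-1, -1) isT isT isT.
(* Two directions without a face split the four corners of [fs] into two groups with different
   winding numbers, while all corners in H share the value [k]. *)
have arc P Q : P \in axdirs -> Q \in axdirs -> ~~ E P -> ~~ E Q ->
  exists s : pt -> int, exists k : int, (forall d, d \in diagdirs -> K d -> s d = k) /\
   [/\ s (-1, 1) - s (1, 1) = (Q == (0, 1))%:R - (P == (0, 1))%:R,
        s (-1, -1) - s (1, -1) = (P == (0, -1))%:R - (Q == (0, -1))%:R,
        s (1, 1) - s (1, -1) = (Q == (1, 0))%:R - (P == (1, 0))%:R
      & s (-1, 1) - s (-1, -1) = (P == (-1, 0))%:R - (Q == (-1, 0))%:R].
  move=> Pax Qax PF QF; have [s [k [sk [h1 h2 h3 h4]]]] := side P Q Pax Qax PF QF.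
  by exists (fun d => s ((d.1 - 1) %/ 2)%Z ((d.2 - 1) %/ 2)%Z), k.
(* Names list the missing directions by compass: two adjacent ones cut off the corner between them,
   two opposite ones separate two halves. *)
have EN : ~~ E (1, 0) -> ~~ E (0, 1) -> ~~ (K (1, 1) && [|| K (-1, 1), K (-1, -1) | K (1, -1)]).
  move=> p q; have [s [k [sk [h1 h2 h3 h4]]]] := arc (1, 0) (0, 1) isT isT p q; apply/negP => /andP[] /sk - /(_ isT) k1.
  by case/or3P => /sk - /(_ isT) k2; move: k1 k2 h1 h2 h3 h4; clear; rewrite !xpair_eqE /=; lia.
have ES : ~~ E (1, 0) -> ~~ E (0, -1) -> ~~ (K (1, -1) && [|| K (-1, 1), K (-1, -1) | K (1, 1)]).
  move=> p q; have [s [k [sk [h1 h2 h3 h4]]]] := arc (1, 0) (0, -1) isT isT p q; apply/negP => /andP[] /sk - /(_ isT) k1.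
  by case/or3P => /sk - /(_ isT) k2; move: k1 k2 h1 h2 h3 h4; clear; rewrite !xpair_eqE /=; lia.
have WN : ~~ E (-1, 0) -> ~~ E (0, 1) -> ~~ (K (-1, 1) && [|| K (1, 1), K (-1, -1) | K (1, -1)]).
  move=> p q; have [s [k [sk [h1 h2 h3 h4]]]] := arc (-1, 0) (0, 1) isT isT p q; apply/negP => /andP[] /sk - /(_ isT) k1.
  by case/or3P => /sk - /(_ isT) k2; move: k1 k2 h1 h2 h3 h4; clear; rewrite !xpair_eqE /=; lia.
have WS : ~~ E (-1, 0) -> ~~ E (0, -1) -> ~~ (K (-1, -1) && [|| K (1, 1), K (-1, 1) | K (1, -1)]).
  move=> p q; have [s [k [sk [h1 h2 h3 h4]]]] := arc (-1, 0) (0, -1) isT isT p q; apply/negP => /andP[] /sk - /(_ isT) k1.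
  by case/or3P => /sk - /(_ isT) k2; move: k1 k2 h1 h2 h3 h4; clear; rewrite !xpair_eqE /=; lia.
have EW : ~~ E (1, 0) -> ~~ E (-1, 0) -> ~~ (K (1, 1) && K (1, -1)).
  move=> p q; have [s [k [sk [h1 h2 h3 h4]]]] := arc (1, 0) (-1, 0) isT isT p q; apply/negP => /andP[] /sk - /(_ isT) k1.
  by move=> /sk - /(_ isT) k2; move: k1 k2 h1 h2 h3 h4; clear; rewrite !xpair_eqE /=; lia.
have NS : ~~ E (0, 1) -> ~~ E (0, -1) -> ~~ (K (1, 1) && K (-1, 1)).
  move=> p q; have [s [k [sk [h1 h2 h3 h4]]]] := arc (0, 1) (0, -1) isT isT p q; apply/negP => /andP[] /sk - /(_ isT) k1.
  by move=> /sk - /(_ isT) k2; move: k1 k2 h1 h2 h3 h4; clear; rewrite !xpair_eqE /=; lia.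
have e1 : [|| E (1, 0), E (-1, 0), E (0, 1) | E (0, -1)].
  by have [d + dF] := some_face; rewrite !inE => /or4P[] /eqP e; move: dF; rewrite e -/(E _) => ->; rewrite ?orbT.
have e2 : ~~ [&& E (1, 0), E (-1, 0), E (0, 1) & E (0, -1)].
  by have [d + dF] := some_out; rewrite !inE => /or4P[] /eqP e; move: dF; rewrite e -/(E _) => /negbTE->; rewrite ?andbF.
rewrite -!/(E _) -!/(K _) in i1 i2 i3 i4 i5 i6 i7 i8 *.
(* What is left is a Boolean check over four sides and four corners. *)
move: (E (1, 0)) (E (-1, 0)) (E (0, 1)) (E (0, -1)) (K (1, 1)) (K (-1, 1)) (K (1, -1)) (K (-1, -1))
  i1 i2 i3 i4 i5 i6 i7 i8 EN ES WN WS EW NS e1 e2.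
clear; case; case; case; case=> //; case; case; case; case=> /= h1 h2 h3 h4 h5 h6 h7 h8 k1 k2 k3 k4 k5 k6 _ _;
  rewrite ?addr0 ?add0r //;
  first [by move: (h1 isT) | by move: (h2 isT) | by move: (h3 isT) | by move: (h4 isT)
    | by move: (h5 isT) | by move: (h6 isT) | by move: (h7 isT) | by move: (h8 isT)
    | by move: (k1 isT isT) | by move: (k2 isT isT) | by move: (k3 isT isT)
    | by move: (k4 isT isT) | by move: (k5 isT isT) | by move: (k6 isT isT) | ring].
Qed.
End Corners.

(** * Counting *)

Lemma psub_diag_opp p q : (psub p q \in diagdirs) = (psub q p \in diagdirs).
Proof. by case: p q => x y [x' y']; rewrite /psub !inE !xpair_eqE /=; lia. Qed.

Lemma sum_diag (V : seq pt) (p : pt) : uniq V ->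
  \sum_(w : seq_sub V) (psub (val w) p \in diagdirs)%:R
  = \sum_(d <- diagdirs) (padd p d \in V)%:R :> rat.
Proof.
move=> uV; rewrite (sum_seq_sub (fun q => (psub q p \in diagdirs)%:R)) //.
pose h q : rat := (psub q p \in diagdirs)%:R * (q \in V)%:R.
transitivity (\sum_(q <- V) h q).
  by apply: eq_big_seq => q qV; rewrite /h qV mulr1.
rewrite (@big_seq_support _ _ _ [seq padd p d | d <- diagdirs] h) //.
- rewrite big_map; apply: eq_big_seq => d dd.
  by rewrite /h psub_padd dd mul1r.
- by rewrite map_inj_uniq // => d d' /(congr1 (psub^~ p)); rewrite !psub_padd.
move=> q; rewrite mulf_eq0 negb_or !pnatr_eq0 !eqb0 !negbK => /andP[qp ->].
by rewrite andTb; apply/mapP; exists (psub q p); rewrite ?psub_dirs.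
Qed.

Lemma gadj_white p q : white p -> white q -> gadj p q = (psub p q \in diagdirs).
Proof.
move=> pw qw; rewrite /gadj pw qw /=; case ax: (psub p q \in axdirs) => //=.
by have := axdirs_white ax; rewrite pw qw.
Qed.

(* A dimer covering misses no vertex and there are two more white vertices than black ones, so
   exactly one of its edges joins two white vertices. *)
Lemma one_impurity (V : seq pt) (D : {set {set seq_sub V}}) : dimer D ->
  \sum_(u : seq_sub V) ((white (val u))%:R - (~~ white (val u))%:R) = 2 :> rat ->
  \sum_(u : seq_sub V) \sum_(w : seq_sub V)
    (inW1 (val u) && (psub (val w) (val u) \in diagdirs))%:R * ([set u; w] \in D)%:R = 1 :> rat.
Proof.
move=> dD excess; have [f [fadj ff fD]] := dimer_mate dD.
pose wh (u : seq_sub V) := white (val u).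
have f_inj : injective f by apply: can_inj ff.
(* A diagonal edge has exactly one end in W1, so each impurity is counted once, at that end. *)
transitivity (\sum_u (inW1 (val u) && wh (f u))%:R : rat).
  apply: eq_bigr => u _; rewrite (bigD1 (f u)) //= big1 ?addr0 => [|w wfu].
    case u1 : (inW1 (val u)); rewrite ?mul0r //=.
    have uw : white (val u) by rewrite white_even2 u1 orbT.
    have ufu : u != f u by apply/eqP => e; have := fadj u; rewrite /tadj -e (negbTE (gadj_irr _)).
    rewrite (mate_edge ff fD ufu) eqxx mulr1; congr (_%:R); congr nat_of_bool.
    apply/idP/idP => [dg|fw]; last by rewrite -(gadj_white fw uw) gadjC; apply: fadj.
    move: dg => /diag_even2 - /(_ (val u)); rewrite psub_dirs u1 /wh white_even2 => -> //.
  case dg : (psub (val w) (val u) \in diagdirs); rewrite ?andbF ?mul0r //.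
  have uw : u != w by apply: contraTneq dg => ->; case: (val w) => x y; rewrite /psub /= !subrr.
  by rewrite (mate_edge ff fD uw) eq_sym (negbTE wfu) mulr0.
have reidx (g : seq_sub V -> rat) : \sum_u g (f u) = \sum_u g u by rewrite [RHS](reindex_inj f_inj).
have black_white u : ~~ wh u -> wh (f u).
  move=> ub; have := fadj u; rewrite /tadj gadj_black // => /axdirs_white e.
  by move: ub; rewrite /wh e negbK.
have s1 : \sum_u (wh u && ~~ wh (f u))%:R = \sum_u (~~ wh u)%:R :> rat.
  rewrite -(reidx (fun u => (wh u && ~~ wh (f u))%:R)); apply: eq_bigr => u _; rewrite ff.
  by case ub : (wh u); rewrite ?andbF // black_white ?ub.
(* The partner map exchanges the two ends of each impurity. The white vertices with white partner
   are thus twice the impurities, and by [s1] their number is the excess. *)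
have s2 : \sum_u (even2 (val u) && wh (f u))%:R = \sum_u (inW1 (val u) && wh (f u))%:R :> rat.
  rewrite -(reidx (fun u => (even2 (val u) && wh (f u))%:R)); apply: eq_bigr => u _; rewrite ff.
  congr (_%:R); congr nat_of_bool.
  have := fadj u; rewrite /tadj /wh; case uw : (white (val u)); last first.
    by move: uw; rewrite white_even2 => /norP; case: inW1 => //= -[]; rewrite andbF.
  case fw : (white (val (f u))); last first.
    by move: fw; rewrite white_even2 andbF => /norP[/negbTE->].
  rewrite gadj_white // psub_diag_opp !andbT => /diag_even2 - /(_ (val u)).
  by rewrite psub_dirs.
have s3 : \sum_u ((wh u)%:R - (wh u && ~~ wh (f u))%:R)
    = \sum_u ((inW1 (val u) && wh (f u))%:R + (even2 (val u) && wh (f u))%:R) :> rat.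
  apply: eq_bigr => u _; rewrite /wh white_even2.
  case u1 : (inW1 (val u)); first by rewrite (inW1_even2 u1); case: white; rewrite /=; ring.
  by case: even2; case: white; rewrite /=; ring.
by move: excess s3; rewrite !sumrB !big_split /= s1 s2 -!/(wh _); lra.
Qed.

Section Main.
Variables (F : seq pt) (fs : pt).
Hypothesis hFuniq : uniq F.
Hypothesis hFW1 : all inW1 F.
Hypothesis hFsc : faces_simply_connected F.
Hypothesis hfsW1 : inW1 fs.
Hypothesis hfsF : fs \notin F.
Hypothesis hperp : lamperp_simply_connected (fs :: F).
Hypothesis hconn : connected_in (predC (mem (VG F fs))) gadj.
Local Notation V := (VG F fs).
Local Notation T := (seq_sub V).
Variable vs : pt.
Hypothesis hvs : vs \in cornersH F.

Let V_uniq : uniq V := undup_uniq _.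

(** [D] is the absolute determinant with the columns of [fs] and any one corner deleted; its
    positivity is what allows it to cancel later. *)
Lemma card_dimer_pair : exists2 D : rat, 0 < D & forall v w : T,
  val v \in VHperp F fs -> psub (val w) (val v) \in diagdirs ->
  #|[set d : {set {set T}} | dimer d && ([set v; w] \in d)]|%:R = pfun F fs (val v) * D.
Proof.
have fsV : fs \in V by rewrite memVG eqxx orbT.
have vsV : vs \in V by rewrite memVG hvs.
pose fsT : T := SeqSub fsV; have fsTE : val fsT = fs by [].
have [D D0 Dw] := corner_dets hFW1 hFsc hfsW1 hfsF fsTE (w0 := SeqSub vsV) hvs.
exists D => // v w vH wv.
have v1 : inW1 (val v) by move: vH; rewrite inE => /predU1P[->|/(allP hFW1)].
have w0 : val w \in cornersH F.
  have w2 : even2 (val w) by rewrite -(psub_dirs (val w) (val v)) diag_even2.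
  by rewrite -(VG_even2 hFW1 hfsW1 w2) //; apply: valP.
have [n [bn [wn [en detD]]]] := Dw w w0.
have count v' wn' : psub (val w) (val v') \in diagdirs -> white (val v') ->
    enumeration bn wn' v' w ->
    #|[set d : {set {set T}} | dimer d && ([set v'; w] \in d)]|%:R = `|\det (kmx bn wn')|.
  move=> wv' vw' [ep eb ew]; apply: card_dimer_det => //.
  by rewrite psub_diag_opp.
have vw : white (val v) by rewrite white_even2 v1 orbT.
move: vH; rewrite inE => /predU1P[vfs|vF].
  have vT : v = fsT by apply: val_inj.
  rewrite (_ : pfun F fs (val v) = 1); last by rewrite /pfun vfs eqxx.
  by rewrite mul1r -detD (count v wn) // vT.
have det0 : \det (kmx bn wn) != 0 by rewrite -normr_gt0 detD.
have [wn' en' det'] := det_face_swap hFuniq hFW1 hfsW1 hfsF fsTE en w0 det0 vF.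
by rewrite (count v wn') // det' detD pfun_face.
Qed.

(** Besides [fs] and [vs], [base_enumeration] lists equally many black and white vertices. *)
Lemma white_excess :
  \sum_(u : T) ((white (val u))%:R - (~~ white (val u))%:R) = 2 :> rat.
Proof.
have fsV : fs \in V by rewrite memVG eqxx orbT.
have vsV : vs \in V by rewrite memVG hvs.
pose fsT : T := SeqSub fsV; have fsTE : val fsT = fs by [].
have [n [bn [wn [[ep eb ew] _]]]] :=
  base_enumeration hFW1 hFsc hfsW1 hfsF fsTE (w := SeqSub vsV) hvs.
rewrite -big_enum (perm_big _ ep) !big_cat /= !big_image /= !big_cons big_nil /=.
rewrite (eq_bigr (fun=> -1)) => [|i _]; last by rewrite (negbTE (eb i)) sub0r.
rewrite [X in _ + (X + _)](eq_bigr (fun=> 1)) => [|i _]; last by rewrite ew subr0.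
rewrite !white_even2 hfsW1 orbT (corner_even2 hFW1 hvs) /= !sumr_const mulNrn; lra.
Qed.

Lemma impurity_probability (v w : T) :
  psub (val w) (val v) \in diagdirs -> val v \in VHperp F fs ->
  (#|[set d : {set {set T}} | dimer d && ([set v; w] \in d)]|%:R
     / #|[set d : {set {set T}} | dimer d]|%:R : rat)
  = pfun F fs (val v)
    / (4 * (\sum_(u <- VHperp F fs) pfun F fs u) + (dstar F fs)%:R - 3).
Proof.
move=> wv vH; have [D D0 cardD] := card_dimer_pair.
rewrite cardD // (_ : #|[set d : {set {set T}} | dimer d]|%:R
  = (4 * (\sum_(u <- VHperp F fs) pfun F fs u) + (dstar F fs)%:R - 3) * D).
  by rewrite invfM mulrACA divff ?mulr1 // gt_eqF.
have VH1 (u : T) : inW1 (val u) = (val u \in VHperp F fs).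
  apply/idP/idP => [u1|]; last by rewrite inE => /predU1P[->|/(allP hFW1)].
  by rewrite inE -(VG_inW1 fs hFW1 u1); apply: valP.
have [c0 c0F] : exists c0, c0 \in F.
  by move: hvs; rewrite cornersE => /hasP[d _ cF]; exists (padd vs d).
pose deg (q : pt) : rat := \sum_(d <- diagdirs) (padd q d \in V)%:R.
transitivity (\sum_(q <- VHperp F fs) pfun F fs q * D * deg q).
  transitivity (\sum_(d in [set d : {set {set T}} | dimer d])
      \sum_(u : T) \sum_(t : T)
      (inW1 (val u) && (psub (val t) (val u) \in diagdirs))%:R * ([set u; t] \in d)%:R : rat).
    rewrite -sum1_card natr_sum; apply: eq_bigr => d; rewrite inE => dd.
    by rewrite (one_impurity dd white_excess).
  rewrite exchange_big /=.
  pose h q : rat := (q \in VHperp F fs)%:R * (pfun F fs q * D * deg q).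
  transitivity (\sum_(u : T) h (val u)).
    apply: eq_bigr => u _; rewrite exchange_big /= /h VH1.
    case uH : (val u \in VHperp F fs); last first.
      by rewrite mul0r big1 // => t _; rewrite big1 // => d _; rewrite mul0r.
    rewrite mul1r /deg -(sum_diag _ V_uniq) mulr_sumr; apply: eq_bigr => t _ /=.
    case tu : (psub (val t) (val u) \in diagdirs); last first.
      by rewrite mulr0 big1 // => d _; rewrite mul0r.
    rewrite mulr1 -(cardD u t) // -sum1_card natr_sum.
    rewrite [LHS]big_mkcond [RHS]big_mkcond; apply: eq_bigr => d _; rewrite !inE.
    by case: (dimer d) => //=; rewrite mul1r; case: (_ \in d).
  rewrite (sum_seq_sub h V_uniq) (@big_seq_support _ _ _ (VHperp F fs)) //=.
  - by apply: eq_big_seq => q qH; rewrite /h qH mul1r.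
  - by rewrite hfsF.
  move=> q; rewrite /h; case qH : (q \in VHperp F fs); last by rewrite mul0r eqxx.
  by move=> _; rewrite andbT memVG; move: qH; rewrite inE => /orP[] ->; rewrite ?orbT.
rewrite /VHperp !big_cons /pfun eqxx -/(pfun F fs).
(* With weight 1, [fs] contributes d* + 1 where the factor 4 would count 4; the discrepancy is d* -
   3. *)
have -> : deg fs = (dstar F fs)%:R + 1.
  rewrite -(corner_count hFuniq hFW1 hFsc hfsW1 hfsF hperp c0F).
  by apply: eq_big_seq => d dd; rewrite (VG_even2 hFW1 hfsW1) // diag_even2.
rewrite (eq_big_seq (fun q => pfun F fs q * (4 * D))) => [|q qF].
  by rewrite -mulr_suml; ring.
have -> : deg q = 4.
  rewrite /deg (eq_big_seq (fun=> 1)) => [|d dd]; last by rewrite memVG face_corner.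
  by rewrite /diagdirs !big_cons big_nil.
by rewrite -mulrA [D * 4]mulrC.
Qed.
End Main.

Theorem mainTheorem10
  (F : seq pt) (fs : pt)
  (hFuniq : uniq F)
  (hFW1 : all inW1 F)
  (hFsc : faces_simply_connected F)
  (hfsW1 : inW1 fs)
  (hfsF : fs \notin F)
  (hperp : lamperp_simply_connected (fs :: F))
  (hvstar : exists vs : pt, vs \in cornersH F /\ psub vs fs \in diagdirs)
  (hnormal : normal_vs (VG F fs))
  (v w : seq_sub (VG F fs))
  (hvw : gadj (val v) (val w))
  (hdiag : psub (val w) (val v) \in diagdirs)
  (hv : val v \in VHperp F fs) :
  (#|[set D : {set {set seq_sub (VG F fs)}} | dimer D && ([set v; w] \in D)]|%:R
     / #|[set D : {set {set seq_sub (VG F fs)}} | dimer D]|%:R : rat)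
  = pfun F fs (val v)
    / (4 * (\sum_(u <- VHperp F fs) pfun F fs u) + (dstar F fs)%:R - 3).
Proof.
have [vs [vs_corner _]] := hvstar.
exact: (impurity_probability hFuniq hFW1 hFsc hfsW1 hfsF hperp hnormal.2 vs_corner hdiag hv).
Qed.
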